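(* Let $d\ge2$ and let $\kappa$ be a probability measure on the unit ball $B\subset\mathbb{R}^d$. Let $\tilde\xi=\xi_1-\xi_2$, where $\xi_1,\xi_2$ are independent with distribution $\kappa$. Assume that there are a finite non-trivial measure $\sigma$ on $\mathbb{S}^{d-1}$, a number $\gamma>0$ and numbers $0<\delta'<\delta''<\frac12$ such that $$\lim_{s\downarrow0}\frac{\mathbf{P}\{\tilde\xi\in C_s(u,z_s)\}}{s^\gamma\,\sigma(C(u,z_s))}=1\qquad\text{and}\qquad \lim_{s\downarrow0}s^{-\gamma/2}\,\kappa\big(D_s(C(u,z_s))\big)=0,$$ both uniformly in $u\in\mathbb{S}^{d-1}$ and $z_s\in[s^{\delta'},s^{\delta''}]$ (the interval with endpoints $s^{\delta'}$ and $s^{\delta''}$). Assume also that there is a function $f$ with $f(x)\to0$ as $x\downarrow0$ such that $\sigma(A)\le f(\mu_{d-1}(A))$ for all measurable $A\subset\mathbb{S}^{d-1}$. Then, for every $t\ge0$, $$\lim_{n\to\infty}\mathbf{P}\left\{n^{2/\gamma}\big(2-\operatorname{diam}(\Pi_{n\kappa})\big)\le t\right\}=1-e^{-\frac12 t^\gamma\sigma_0},\qquad \sigma_0=\sigma(\mathbb{S}^{d-1}).$$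
   Context: $B=\{x\in\mathbb{R}^d:\|x\|\le1\}$ is the closed unit ball, $\mathbb{S}^{d-1}$ is its boundary sphere, and $\mu_{d-1}$ is the surface area measure on $\mathbb{S}^{d-1}$. $\Pi_{n\kappa}$ is the Poisson process on $B$ with intensity measure $n\kappa$. $\operatorname{diam}(F)=\sup_{x,y\in F}\|x-y\|$ (the value assigned to the empty set is immaterial for the limit). For $u\in\mathbb{S}^{d-1}$ and $r>0$: $C(u,r)=\{x\in\mathbb{S}^{d-1}:\|x-u\|\le r\}$ and $C_s(u,r)=\{\rho x:\ x\in C(u,r),\ \rho\in[2-s,2]\}$. For $s\in(0,1)$: $D_s(u)=B\cap\{x\in\mathbb{R}^d:\langle x,u\rangle\ge1-s\}$, and $D_s(A)=\bigcup_{u\in A}D_s(u)$ for $A\subset\mathbb{S}^{d-1}$. Convention for the ratio: if $u$ is not in the support of $\sigma$, then the denominator is zero for all sufficiently small $s$, and the ratio condition is understood as saying that the numerator is also zero for all sufficiently small $s$. Standing assumption: the support of the distribution of $\tilde\xi$ contains points with norms arbitrarily close to $2$. *)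

(* Defs.v *)
From HB Require Import structures.
From mathcomp Require Import all_boot all_order all_algebra.
From mathcomp Require Import all_classical all_reals all_analysis.

Set Implicit Arguments.
Unset Strict Implicit.
Unset Printing Implicit Defensive.

Import Order.TTheory GRing.Theory Num.Theory.
Import numFieldNormedType.Exports.

Local Open Scope classical_set_scope.
Local Open Scope ring_scope.

(* MathComp-Analysis has no sigma-algebra on 'M[R]_(m, n): we equip it with the
   Borel one. The topology of 'M[R]_(m, n) is that of the sup norm, which is
   also the Euclidean topology. *)
Definition borel_mx_display : measure_display.
Proof. exact: default_measure_display. Qed.

Section borel_mx.
Context {R : realType} (m n : nat).

Definition borel_mx : set (set 'M[R]_(m, n)) := <<s @open 'M[R]_(m, n) >>.

Let borel_mx0 : borel_mx set0.
Proof. exact: sigma_algebra0. Qed.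

Let borel_mxC A : borel_mx A -> borel_mx (~` A).
Proof. exact: sigma_algebraC. Qed.

Let borel_mx_bigcup (F : (set 'M[R]_(m, n))^nat) :
  (forall i, borel_mx (F i)) -> borel_mx (\bigcup_i F i).
Proof. exact: sigma_algebra_bigcup. Qed.

HB.instance Definition _ := @isMeasurable.Build borel_mx_display
  'M[R]_(m, n) borel_mx borel_mx0 borel_mxC borel_mx_bigcup.

End borel_mx.

Section euclidean.
Context {R : realType} {d : nat}.
Implicit Types (x y u : 'rV[R]_d) (A F : set 'rV[R]_d) (r s : R).

Definition inner x y : R := \sum_(i < d) x 0 i * y 0 i.

(* The library norm `|x| on 'rV[R]_d is the sup norm. *)
Definition enorm x : R := Num.sqrt (inner x x).

Definition unit_ball : set 'rV[R]_d := [set x | enorm x <= 1].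

Definition unit_sphere : set 'rV[R]_d := [set x | enorm x = 1].

(* [diam set0 = 0], since [sup set0 = 0]. *)
Definition diam F : R := sup [set enorm (xy.1 - xy.2) | xy in F `*` F].

Definition cap u r : set 'rV[R]_d :=
  [set x | unit_sphere x /\ enorm (x - u) <= r].

Definition thick_cap s u r : set 'rV[R]_d :=
  [set rho *: x | rho in `[2 - s, 2] & x in cap u r].

Definition ball_cap s u : set 'rV[R]_d :=
  unit_ball `&` [set x | 1 - s <= inner x u].

Definition ball_caps s A : set 'rV[R]_d := \bigcup_(u in A) ball_cap s u.

(* d-dimensional Lebesgue (outer) measure, by countable covers with boxes. *)
Definition box (a b : 'rV[R]_d) : set 'rV[R]_d :=
  [set x | forall i, a 0 i < x 0 i <= b 0 i].

Definition box_volume (a b : 'rV[R]_d) : R :=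
  \prod_(i < d) Num.max 0 (b 0 i - a 0 i).

Definition lebesgue_rV A : \bar R :=
  ereal_inf [set (\sum_(0 <= k <oo) (box_volume (ab.1 k) (ab.2 k))%:E)%E
            | ab in [set ab : ('rV[R]_d)^nat * ('rV[R]_d)^nat
                    | A `<=` \bigcup_k box (ab.1 k) (ab.2 k)]].

(* Surface area measure of A, for A a Borel subset of the unit sphere: d times
   the volume of the cone over A. *)
Definition surface_area A : \bar R :=
  (d%:R%:E * lebesgue_rV [set (rho *: x)%R | rho in `[0%R, 1%R] & x in A])%E.

Definition msupport (mu : set 'rV[R]_d -> \bar R) : set 'rV[R]_d :=
  [set x | forall U, open U -> U x -> (0 < mu U)%E].

End euclidean.

Section probability.
Context {R : realType} {dO : measure_display} {Omega : measurableType dO}.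
Variable P : probability Omega R.

Definition independent_rv {d1 d2} {T1 : measurableType d1}
    {T2 : measurableType d2} (X : {RV P >-> T1}) (Y : {RV P >-> T2}) : Prop :=
  forall A B, measurable A -> measurable B ->
    P (X @^-1` A `&` Y @^-1` B) = (P (X @^-1` A) * P (Y @^-1` B))%E.

(* Number of points of the configuration [s] in [A], with multiplicity. *)
Definition points_in {T : Type} (s : seq T) (A : set T) : nat :=
  count (fun x => `[< A x >]) s.

(* Poisson process with finite intensity measure Lambda. A realization is a
   finite multiset of points (Lambda may have atoms), given as a list whose
   order plays no role. *)
Record poisson_process {dT} {T : measurableType dT}
    (Lambda : {measure set T -> \bar R}) (Pi : Omega -> seq T) : Prop := {
  pp_finite : (Lambda setT < +oo)%E ;
  pp_measurable : forall A, measurable A ->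
    measurable_fun setT (fun w => points_in (Pi w) A) ;
  (* The second argument of [poisson_prob] is unused. [poisson_prob 0] is the
     Dirac mass at 0. *)
  pp_poisson : forall A, measurable A -> forall U : set nat,
    P [set w | U (points_in (Pi w) A)]
    = poisson_prob (fine (Lambda A)) 0%N U ;
  pp_independent : forall (m : nat) (A : 'I_m -> set T) (k : 'I_m -> nat),
    (forall i, measurable (A i)) -> trivIset setT A ->
    P [set w | forall i, points_in (Pi w) (A i) = k i]
    = (\prod_(i < m) P [set w | points_in (Pi w) (A i) = k i])%E
}.

End probability.

(* |num / den - 1| <= eps, where a vanishing denominator requires a vanishing
   numerator. *)
Definition ratio_near1 {R : realType} (eps num den : R) : Prop :=
  if den == 0 then num = 0 else `|num / den - 1| <= eps.

(* Main.v *)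
Require Import Defs.
From HB Require Import structures.
From mathcomp Require Import all_boot all_order all_algebra.
From mathcomp Require Import all_classical all_reals all_analysis.
From mathcomp Require Import measurable_realfun zify ring lra.

Set Implicit Arguments.
Unset Strict Implicit.
Unset Printing Implicit Defensive.

Import Order.TTheory GRing.Theory Num.Theory.
Import numFieldNormedType.Exports.

Local Open Scope classical_set_scope.
Local Open Scope ring_scope.

(** Put [p s = P0 (2 - s <= enorm (xi1 - xi2) <= 2)] and
    [s = t * n ^ (- 2 / gamma)]. For [s < 2] the diameter of the process is at
    least [2 - s] exactly when two of its points form a far pair, that is, are at
    distance at least [2 - s]. The expected number of far pairs is
    [n ^ 2 * p s / 2]; the theorem holds because this tends to
    [t ^ gamma * sigma0 / 2] and because far pairs behave as independent rare
    events, so that there is none with probability about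
    [expR (- t ^ gamma * sigma0 / 2)].

    The tail of the difference, [p s ~ s ^ gamma * sigma0] ([tail_equiv]). The
    hypothesis compares the law of the difference with [sigma] on caps only, but on
    caps of all radii in a range that spans many scales. Averaging it over a family
    of caps which covers every direction almost equally often ([cap_design])
    replaces caps by the whole sphere. Such a family comes from a grid of [R^d]: a
    ball of radius [r] centred at a grid point [y] near the sphere cuts a cap around
    [y / enorm y] out of the sphere ([sqr_enorm_polar]), and the number of these
    balls that contain a direction [v] is the number of grid points within [r] of
    [v]. Up to a change of [r] by a few mesh widths this number does not depend on
    [v], by translation ([grid_count_shift]); and it grows polynomially in [r], so
    some radius exists at which such a change multiplies it by at most [1 + eps]
    ([slow_growth]). Caps that come out too small are enlarged to the least
    admissible radius [zeta], which only amounts to adding [2 * zeta] to [r].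

    The Poisson approximation ([far_pair_bounds]). Cut the ball into small cells
    [Q_i]. Void probabilities show that the cells are occupied independently, with
    probabilities [1 - expR (- n * kappa Q_i)] ([active_cells_prob]), and up to the
    mesh a far pair is an edge between two occupied cells in the graph of cells
    that are far apart. If vertices of a graph are active independently and every
    vertex has at most [delta] active neighbours on average, then revealing the
    vertices one by one shows that there is no active edge with probability close
    to the exponential of minus the expected number of active edges
    ([stable_prob_bounds]). Here [delta] tends to [0]: the points of the ball far
    from [x] lie in the ball cap opposite to [x] ([far_sub_ball_caps]), whose mass
    is [o (s ^ (gamma / 2)) = o (1 / n)] by hypothesis ([cvg_far_mass]).

    With a mesh of order [scale gamma n / (n + 1)], the two bounds for
    [P n (diam >= 2 - s)] involve [n ^ 2 * p] at
    [(t +- 1 / (n + 1)) * scale gamma n], where [scale gamma n = n ^ (- 2 / gamma)],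
    and they converge to the same limit. *)

(** * The Euclidean norm *)

Section euclidean_norm.
Context {R : realType} {d : nat}.
Implicit Types (x y u v : 'rV[R]_d) (a r : R).

Lemma innerC x y : inner x y = inner y x.
Proof. by apply: eq_bigr => i _; rewrite mulrC. Qed.

Lemma innerDl x y v : inner (x + y) v = inner x v + inner y v.
Proof. by rewrite -big_split; apply: eq_bigr => i _ /=; rewrite mxE mulrDl. Qed.

Lemma innerZl a x y : inner (a *: x) y = a * inner x y.
Proof. by rewrite mulr_sumr; apply: eq_bigr => i _; rewrite mxE mulrA. Qed.

Lemma innerNl x y : inner (- x) y = - inner x y.
Proof. by rewrite -scaleN1r innerZl mulN1r. Qed.

Lemma innerDr x y v : inner v (x + y) = inner v x + inner v y.
Proof. by rewrite ![inner v _]innerC innerDl. Qed.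

Lemma innerZr a x y : inner x (a *: y) = a * inner x y.
Proof. by rewrite ![inner x _]innerC innerZl. Qed.

Lemma innerNr x y : inner x (- y) = - inner x y.
Proof. by rewrite ![inner x _]innerC innerNl. Qed.

Definition innerE := (innerDl, innerDr, innerNl, innerNr, innerZl, innerZr).

Lemma inner_ge0 x : 0 <= inner x x.
Proof. by apply: sumr_ge0 => i _; rewrite -expr2 sqr_ge0. Qed.

Lemma enorm_ge0 x : 0 <= enorm x.
Proof. exact: sqrtr_ge0. Qed.

Lemma sqr_enorm x : enorm x ^+ 2 = inner x x.
Proof. by rewrite sqr_sqrtr // inner_ge0. Qed.

Lemma enorm0 : enorm (0 : 'rV[R]_d) = 0.
Proof. by rewrite /enorm -(scale0r (0 : 'rV[R]_d)) innerZl mul0r sqrtr0. Qed.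

Lemma enormN x : enorm (- x) = enorm x.
Proof. by rewrite /enorm innerNl innerNr opprK. Qed.

Lemma enormB x y : enorm (x - y) = enorm (y - x).
Proof. by rewrite -enormN opprB. Qed.

Lemma enormZ a x : enorm (a *: x) = `|a| * enorm x.
Proof.
by rewrite /enorm innerZl innerZr mulrA -expr2 sqrtrM ?sqr_ge0// sqrtr_sqr.
Qed.

Lemma enorm0_eq0 x : enorm x = 0 -> x = 0.
Proof.
move=> /eqP; rewrite -sqrf_eq0 sqr_enorm psumr_eq0; last first.
  by move=> i _; rewrite -expr2 sqr_ge0.
move=> /allP x0; apply/rowP => i; rewrite mxE; apply/eqP.
by have := x0 i (mem_index_enum _); rewrite /= mulf_eq0 orbb.
Qed.

Lemma inner_le x y : inner x y <= enorm x * enorm y.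
Proof.
have [x0|x0] := eqVneq (enorm x) 0.
  by rewrite (enorm0_eq0 x0) enorm0 mul0r -(scale0r 0) innerZl mul0r.
have [y0|y0] := eqVneq (enorm y) 0.
  by rewrite (enorm0_eq0 y0) enorm0 mulr0 -(scale0r 0) innerZr mul0r.
have xgt : 0 < enorm x by rewrite lt_def x0 enorm_ge0.
have ygt : 0 < enorm y by rewrite lt_def y0 enorm_ge0.
have := inner_ge0 (enorm y *: x - enorm x *: y).
rewrite !innerE -!sqr_enorm (innerC y x) => h.
rewrite -(ler_pM2l (mulr_gt0 xgt ygt)); nra.
Qed.

Lemma ler_enormD x y : enorm (x + y) <= enorm x + enorm y.
Proof.
rewrite -(@ler_pXn2r _ 2) ?nnegrE ?addr_ge0 ?enorm_ge0//.
rewrite sqrrD !sqr_enorm !innerE (innerC y x).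
by have := inner_le x y; lra.
Qed.

Lemma ler_enorm_dist v x y : enorm (x - y) <= enorm (x - v) + enorm (v - y).
Proof. by have := ler_enormD (x - v) (v - y); rewrite addrA subrK. Qed.

Lemma ler_enormB x y : enorm (x - y) <= enorm x + enorm y.
Proof. by rewrite -(enormN y) ler_enormD. Qed.

Lemma ler_dist_enorm x y : `|enorm x - enorm y| <= enorm (x - y).
Proof.
rewrite ler_norml; apply/andP; split.
  by have := ler_enormD (y - x) x; rewrite subrK enormB; lra.
by have := ler_enormD (x - y) y; rewrite subrK; lra.
Qed.

Lemma ler_coord_enorm x (i : 'I_d) : `|x 0 i| <= enorm x.
Proof.
rewrite -(@ler_pXn2r _ 2) ?nnegrE ?normr_ge0 ?enorm_ge0//.
rewrite sqr_enorm real_normK ?num_real// /inner (bigD1 i)//= expr2 lerDl.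
by apply: sumr_ge0 => j _; rewrite -expr2 sqr_ge0.
Qed.

Lemma enorm_le_coord x r : 0 <= r ->
  (forall i : 'I_d, `|x 0 i| <= r) -> enorm x <= d%:R * r.
Proof.
move=> r0 xr; rewrite -(@ler_pXn2r _ 2) ?nnegrE ?mulr_ge0 ?enorm_ge0//.
rewrite sqr_enorm; apply: (@le_trans _ _ (\sum_(i < d) r ^+ 2)).
  apply: ler_sum => i _; rewrite -expr2 -real_normK ?num_real//.
  by rewrite ler_pXn2r ?nnegrE.
rewrite sumr_const card_ord exprMn -[leLHS]mulr_natl ler_wpM2r ?sqr_ge0//.
by rewrite -natrX ler_nat; case: (d) => // k; rewrite leq_pmulr.
Qed.

(** The polar form of the distance to a point of the sphere: it turns the trace
    on the sphere of a ball centred off the sphere into a cap. *)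
Lemma sqr_enorm_polar a u v : unit_sphere u -> unit_sphere v ->
  enorm (a *: u - v) ^+ 2 = (1 - a) ^+ 2 + a * enorm (u - v) ^+ 2.
Proof.
rewrite /unit_sphere/= => u1 v1.
rewrite !sqr_enorm !innerE -!sqr_enorm u1 v1 (innerC v u); ring.
Qed.

Lemma normalize_sphere x : enorm x != 0 -> unit_sphere ((enorm x)^-1 *: x).
Proof.
by move=> x0; rewrite /unit_sphere/= enormZ ger0_norm ?invr_ge0 ?enorm_ge0 ?mulVf.
Qed.

End euclidean_norm.

(** * Borel sets of row vectors *)

Section borel_sets.
Context {R : realType} {d : nat}.
Local Notation V := 'rV[R]_d.

Lemma open_measurable_rV (U : set V) : open U -> measurable U.
Proof. by move=> oU; apply: sub_sigma_algebra. Qed.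

Lemma measurable_coord (i : 'I_d) :
  measurable_fun setT (fun x : V => x 0 i).
Proof.
apply: (measurability (@RGenOInfty.G R)).
  exact: RGenOInfty.measurableE.
move=> _ [_ [a ->] <-]; rewrite setTI; apply: open_measurable_rV.
apply: open_comp; first by move=> x _; exact: coord_continuous.
rewrite set_itvE; exact: open_gt.
Qed.

(** Measurability is only ever needed of sets cut out by inequalities between
    norms and inner products, so measurability of the coordinates suffices. *)
Definition coord_measurable {dT} {T : measurableType dT} (X : T -> V) :=
  forall i, measurable_fun setT (fun w => X w 0 i).

Context {dT} {T : measurableType dT}.
Implicit Types (X Y : T -> V) (g : T -> R).

Lemma coord_measurable_comp X : measurable_fun setT X -> coord_measurable X.
Proof.
by move=> mX i; apply: (measurableT_comp (measurable_coord i) mX).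
Qed.

Lemma coord_measurableB X Y : coord_measurable X -> coord_measurable Y ->
  coord_measurable (fun w => X w - Y w).
Proof.
move=> mX mY i.
rewrite (_ : (fun _ => _) = (fun w => X w 0 i - Y w 0 i)).
  exact: measurable_funB.
by apply/funext => w; rewrite !mxE.
Qed.

Lemma coord_measurableZ g X : measurable_fun setT g -> coord_measurable X ->
  coord_measurable (fun w => g w *: X w).
Proof.
move=> mg mX i.
rewrite (_ : (fun _ => _) = (fun w => g w * X w 0 i)).
  exact: measurable_funM.
by apply/funext => w; rewrite !mxE.
Qed.

Lemma coord_measurable_cst (u : V) : coord_measurable (fun _ : T => u).
Proof. by move=> i; exact: measurable_cst. Qed.

Lemma measurable_inner X Y : coord_measurable X -> coord_measurable Y ->
  measurable_fun setT (fun w => inner (X w) (Y w)).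
Proof.
by move=> mX mY; apply: measurable_sum => i; exact: measurable_funM.
Qed.

Lemma measurable_enorm X : coord_measurable X ->
  measurable_fun setT (fun w => enorm (X w)).
Proof.
move=> mX; apply: (@measurableT_comp _ _ _ _ _ _ (@Num.sqrt R)).
  by apply: continuous_measurable_fun; exact: sqrt_continuous.
exact: measurable_inner.
Qed.

Lemma measurable_le_set (f g : T -> R) :
  measurable_fun setT f -> measurable_fun setT g ->
  measurable [set w | f w <= g w].
Proof.
move=> mf mg; rewrite -[X in measurable X]setTI.
exact: (measurable_fun_ler mf mg measurableT (Y := [set true])).
Qed.

Lemma measurable_lt_set (f g : T -> R) :
  measurable_fun setT f -> measurable_fun setT g ->
  measurable [set w | f w < g w].
Proof.
move=> mf mg; rewrite -[X in measurable X]setTI.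
exact: (measurable_fun_ltr mf mg measurableT (Y := [set true])).
Qed.

End borel_sets.

Section borel_regions.
Context {R : realType} {d : nat}.
Local Notation V := 'rV[R]_d.
Implicit Types (u : V) (r s : R).

Lemma coord_measurable_id : coord_measurable (@id V).
Proof. exact: measurable_coord. Qed.

Lemma measurable_unit_ball : measurable (unit_ball : set V).
Proof.
apply: measurable_le_set; last exact: measurable_cst.
exact: (measurable_enorm coord_measurable_id).
Qed.

Lemma measurable_unit_sphere : measurable (unit_sphere : set V).
Proof.
rewrite (_ : unit_sphere = unit_ball `&` [set x : V | 1 <= enorm x]).
  apply: measurableI; first exact: measurable_unit_ball.
  apply: measurable_le_set; first exact: measurable_cst.
  exact: (measurable_enorm coord_measurable_id).
apply/seteqP; split => x; rewrite /unit_sphere/unit_ball/=.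
  by move=> ->.
by case=> x1 x2; apply/eqP; rewrite eq_le x1 x2.
Qed.

Lemma measurable_cap u r : measurable (cap u r).
Proof.
apply: measurableI; first exact: measurable_unit_sphere.
apply: measurable_le_set; last exact: measurable_cst.
apply: measurable_enorm; apply: coord_measurableB.
  exact: coord_measurable_id.
exact: coord_measurable_cst.
Qed.

Lemma thick_capE s u r (x : V) : s < 2 ->
  thick_cap s u r x <->
  2 - s <= enorm x <= 2 /\ enorm ((enorm x)^-1 *: x - u) <= r.
Proof.
move=> s2; split.
  move=> [rho /=]; rewrite in_itv/= => /andP[rho1 rho2] [y [y1 yr] <-].
  have rho0 : 0 < rho by lra.
  move: y1; rewrite /unit_sphere/= => y1.
  rewrite enormZ y1 mulr1 gtr0_norm// rho1 rho2; split => //.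
  by rewrite scalerA mulVf ?gt_eqF// scale1r.
move=> [/andP[x1 x2] xr]; exists (enorm x); first by rewrite /= in_itv/= x1.
have x0 : enorm x != 0 by rewrite gt_eqF//; lra.
exists ((enorm x)^-1 *: x); last by rewrite scalerA mulfV// scale1r.
by split => //; exact: normalize_sphere.
Qed.

(** Thick caps are pulled back along a difference of random vectors of which
    only the coordinates are known to be measurable. *)
Lemma measurable_preimage_thick_cap {dT} {T : measurableType dT} (X : T -> V)
    s u r : s < 2 -> coord_measurable X -> measurable (X @^-1` thick_cap s u r).
Proof.
move=> s2 mX.
have mn := measurable_enorm mX.
rewrite (_ : _ @^-1` _ = [set w | 2 - s <= enorm (X w)]
   `&` [set w | enorm (X w) <= 2]
   `&` [set w | enorm (X w - enorm (X w) *: u) <= r * enorm (X w)]).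
  apply: measurableI; first apply: measurableI.
  - by apply: measurable_le_set => //; exact: measurable_cst.
  - by apply: measurable_le_set => //; exact: measurable_cst.
  - apply: measurable_le_set.
      apply: measurable_enorm; apply: coord_measurableB => //.
      by apply: coord_measurableZ => //; exact: coord_measurable_cst.
    by apply: measurable_funM => //; exact: measurable_cst.
have key w : 2 - s <= enorm (X w) ->
    (enorm ((enorm (X w))^-1 *: X w - u) <= r) =
    (enorm (X w - enorm (X w) *: u) <= r * enorm (X w)).
  move=> h; have x0 : 0 < enorm (X w) by lra.
  rewrite -[in RHS](ger0_norm (ltW x0)).
  rewrite -[LHS](ler_pM2r x0) -[in X in _ * X <= _](ger0_norm (ltW x0)).
  rewrite [in LHS]mulrC -enormZ !ger0_norm ?(ltW x0)// scalerBr scalerA mulfV ?gt_eqF//.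
  by rewrite scale1r.
apply/seteqP; split => w; rewrite /preimage/=.
  by move=> /(thick_capE _ _ _ s2)[/andP[h1 h2]]; rewrite key.
move=> [[h1 h2] h3]; apply/(thick_capE _ _ _ s2).
by rewrite h1 h2 key.
Qed.

End borel_regions.

Section borel_ball_caps.
Context {R : realType} {d : nat}.
Local Notation V := 'rV[R]_d.
Implicit Types (u : V) (r s : R).

Lemma continuous_inner (y : V) : continuous (fun x : V => inner y x).
Proof.
apply: continuous_big; first exact: add_continuous.
move=> i _ x; apply: (@cvgM _ _ (nbhs x)); first exact: cvg_cst.
exact: coord_continuous.
Qed.

Lemma continuous_enorm : continuous (@enorm R d).
Proof.
move=> x; apply: continuous_comp; last exact: sqrt_continuous.
have : continuous (fun y : V => inner y y); last exact.
apply: continuous_big; first exact: add_continuous.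
by move=> i _ y; apply: (@cvgM _ _ (nbhs y)); exact: coord_continuous.
Qed.

Lemma compact_cap u r : compact (cap u r).
Proof.
apply: bounded_closed_compact.
  exists 1; split => // M M1 x [x1 _].
  rewrite /= [leLHS]/Num.norm/= mx_normrE.
  apply/bigmax_leP; split; first by apply: ltW; lra.
  move=> [i j] _ /=; rewrite ord1.
  apply: (le_trans (ler_coord_enorm _ _)); move: x1.
  by rewrite /unit_sphere/= => ->; exact: ltW.
apply: closedI.
  suff : closed (@enorm R d @^-1` [set 1]) by [].
  apply: preimage_closed; first by move=> x _; exact: continuous_enorm.
  exact: closed_eq.
suff : closed ((fun x : V => enorm (x - u)) @^-1` [set z | z <= r]) by [].
apply: preimage_closed; last exact: closed_le.
move=> x _; apply: continuous_comp; last exact: continuous_enorm.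
exact: (cvgB (@cvg_id _ (nbhs x)) (cvg_cst u)).
Qed.

(** By compactness of the cap, the uncountable union of closed half-spaces in
    [ball_caps] is a countable intersection of unions of open half-spaces. *)
Lemma measurable_ball_caps s u r : measurable (ball_caps s (cap u r)).
Proof.
pose H k : set V := \bigcup_(x in cap u r)
  [set y | 1 - s - k.+1%:R^-1 < inner x y].
rewrite (_ : ball_caps _ _ = unit_ball `&` \bigcap_k H k).
  apply: measurableI; first exact: measurable_unit_ball.
  apply: bigcap_measurable => [|k _]; first by exists 0%N.
  apply: open_measurable_rV; apply: bigcup_open => x _.
  suff : open ((inner x) @^-1` [set z | z > 1 - s - k.+1%:R^-1]) by [].
  by apply: open_comp; [move=> y _; exact: continuous_inner|exact: open_gt].
apply/seteqP; split => y.
  move=> [x cx [y1 /= xy]]; split => // k _; exists x => //=.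
  by rewrite innerC (lt_le_trans _ xy)// ltrBlDr ltrDl invr_gt0.
move=> [y1 yH].
have [c0|/set0P/negP/negPn/eqP c0] := pselect (cap u r !=set0); last first.
  by have [x] := yH 0%N Logic.I; rewrite c0.
have [x] := EVT_max_rV c0 (@compact_cap u r)
  (continuous_subspaceT (@continuous_inner y)).
rewrite inE => cx xmax; exists x => //; split => //=.
rewrite leNgt; apply/negP => /ltr_add_invr[k ke].
have [x' cx' /= h] := yH k Logic.I.
have := xmax x'; rewrite inE => /(_ cx') xx'; rewrite innerC in h.
by have := lt_le_trans h xx'; rewrite ltrBlDr => /(lt_trans ke); rewrite ltxx.
Qed.

End borel_ball_caps.

(** * Families of caps covering all directions almost equally *)

Section growth.
Context {R : realType}.

(** With [K = 2 * k * d] the claim is the [d]-th power of an inequality that is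
    linear in [k] on one side and, by Bernoulli, quadratic on the other. *)
Lemma exp_beats_poly (e : R) (d : nat) : 0 < e -> (0 < d)%N ->
  exists K : nat, ((8 * K * d).+1 ^ d)%:R < (1 + e) ^+ K :> R.
Proof.
move=> e0 d0.
have e20 : 0 < e ^+ 2 by rewrite exprn_gt0.
pose k := (Num.truncn ((16 * d ^ 2)%:R / e ^+ 2 : R)).+1.
have hk : (16 * d ^ 2)%:R < k%:R * e ^+ 2 :> R.
  by rewrite -ltr_pdivrMr// /k truncnS_gt.
exists (2 * k * d)%N.
rewrite exprM natrX ltr_pXn2r ?nnegrE// ?ler0n ?exprn_ge0//; try lra.
have k1 : 1 <= k%:R :> R by rewrite ler1n.
have bern : 1 + k%:R * e <= (1 + e) ^+ k.
  elim: (k) => [|m ih]; first by rewrite mul0r addr0 expr0.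
  rewrite exprS; apply: (@le_trans _ _ ((1 + e) * (1 + m%:R * e))).
    by rewrite -[m.+1%:R]natr1; have := ler0n R m; nra.
  by rewrite ler_wpM2l//; lra.
have -> : (1 + e) ^+ (2 * k) = ((1 + e) ^+ k) ^+ 2 by rewrite -exprM mulnC.
have -> : (8 * (2 * k * d) * d).+1 = (k * (16 * d ^ 2) + 1)%N.
  by rewrite -mulnn; lia.
apply: (@lt_le_trans _ _ ((1 + k%:R * e) ^+ 2)).
  by rewrite natrD natrM; nra.
by rewrite ler_pXn2r ?nnegrE ?exprn_ge0//; nra.
Qed.

(** If no step were this slow, the sequence would dominate a geometric one. *)
Lemma slow_growth (e : R) (a : nat -> R) (K : nat) : 0 < e -> 1 <= a 0%N ->
  a K < (1 + e) ^+ K -> exists2 j, (j < K)%N & a j.+1 <= (1 + e) * a j.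
Proof.
move=> e0 a0 aK; apply: contrapT => h.
suff : forall j, (j <= K)%N -> (1 + e) ^+ j <= a j.
  by move=> /(_ K (leqnn _)); rewrite leNgt aK.
elim=> [_|j ih jK]; first by rewrite expr0.
rewrite leNgt; apply/negP => aj; apply: h; exists j => //.
apply/ltW/(lt_le_trans aj); rewrite exprS ler_wpM2l ?ih ?(ltnW jK)//; lra.
Qed.

End growth.

Section grid.
Context {R : realType} {d : nat}.
Local Notation V := 'rV[R]_d.
Variables (eta : R) (L : nat).
Hypothesis eta_gt0 : 0 < eta.
Local Notation T := {ffun 'I_d -> 'I_L.*2.+1}.

(** The grid is cut down to coordinates of absolute value at most [L * eta] to make
    it finite; [L] will be taken so large that no ball of interest meets the
    boundary. *)
Definition grid_point (k : T) : V := \row_i (eta * ((k i)%:R - L%:R)).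

Definition grid_count (v : V) (r : R) : nat :=
  #|[pred k : T | enorm (grid_point k - v) <= r]|.

(** Translation by a grid vector is injective on grid points, and it moves the ball
    around [v] into the ball around [v'] as soon as [v'] is close enough to the
    translate of [v]. *)
Lemma grid_count_shift (f : 'I_d -> int) (v v' : V) (r r' : R) :
  (forall k : T, enorm (grid_point k - v) <= r ->
    forall i, 0 <= (k i)%:Z + f i <= L.*2%:Z) ->
  enorm (v + \row_i (eta * (f i)%:~R) - v') <= r' - r ->
  (grid_count v r <= grid_count v' r')%N.
Proof.
move=> hf vv'.
pose g (k : T) : T := [ffun i => inord (absz ((k i)%:Z + f i)%R)].
have gE k i : enorm (grid_point k - v) <= r ->
    (g k i)%:Z = (k i)%:Z + f i.
  move=> /hf/(_ i)/andP[h1 h2]; rewrite ffunE inordK; first by rewrite gez0_abs.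
  by rewrite ltnS -lez_nat gez0_abs.
apply: (@leq_trans #|[pred x in [set g k | k in [pred k : T | enorm (grid_point k - v) <= r]]%SET]|).
  rewrite [leqRHS](_ : _ = #|[set g k | k in [pred k : T | enorm (grid_point k - v) <= r]]%SET|); last by apply: eq_card.
  rewrite card_in_imset// => k1 k2; rewrite !inE => h1 h2 gg.
  apply/ffunP => i; apply/val_inj; apply/eqP; rewrite -eqz_nat.
  by have := gE k1 i h1; rewrite gg (gE k2 i h2) => /addIr ->.
apply: subset_leq_card; apply/fintype.subsetP => x; rewrite !inE.
move=> /imsetP[k]; rewrite !inE => hk ->.
rewrite (_ : grid_point (g k) = grid_point k + \row_i (eta * (f i)%:~R)).
  have := ler_enormD (grid_point k - v) (v + \row_i (eta * (f i)%:~R) - v').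
  rewrite (_ : grid_point k - v + _ =
    grid_point k + \row_i (eta * (f i)%:~R) - v'); first lra.
  by rewrite -!addrA addKr.
apply/rowP => i; rewrite !mxE.
have -> : ((g k i)%:R : R) = ((g k i)%:Z)%:~R by [].
by rewrite gE// intrD; ring.
Qed.

Lemma grid_count0_gt0 (r : R) : 0 <= r -> (0 < grid_count 0 r)%N.
Proof.
move=> r0; apply/card_gt0P; exists [ffun => inord L]; rewrite inE.
rewrite (_ : grid_point _ = 0) ?subrr ?enorm0//.
apply/rowP => i; rewrite !mxE ffunE inordK ?subrr ?mulr0//.
by rewrite ltnS -addnn leq_addr.
Qed.

(** The bound does not involve [L]: only the ratio of the radius to the mesh
    matters, and this makes [cap_design] uniform in [zeta]. *)
Lemma grid_count0_le (m : nat) (r : R) : r <= eta * m%:R ->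
  (grid_count 0 r <= m.*2.+1 ^ d)%N.
Proof.
move=> rm.
pose g (k : T) : {ffun 'I_d -> 'I_m.*2.+1} := [ffun i => inord (k i + m - L)].
have kP k i : enorm (grid_point k - 0) <= r -> (k i <= L + m /\ L <= k i + m)%N.
  move=> h; have := le_trans (le_trans (ler_coord_enorm _ i) h) rm.
  rewrite !mxE subr0 normrM (gtr0_norm eta_gt0) ler_pM2l//.
  rewrite ler_norml => /andP[h1 h2].
  by split; rewrite -(ler_nat R) natrD; lra.
have gE k i : enorm (grid_point k - 0) <= r -> g k i = (k i + m - L)%N :> nat.
  by move=> /kP-/(_ i)[h1 h2]; rewrite ffunE inordK//; lia.
rewrite -[X in (_ <= X ^ _)%N]card_ord -[X in (_ <= _ ^ X)%N]card_ord -card_ffun.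
apply: (@leq_card_in _ _ g) => k1 k2; rewrite !inE => h1 h2 gg.
apply/ffunP => i; apply/val_inj => /=.
have := gE k1 i h1; rewrite gg gE//.
by have := kP k1 i h1; have := kP k2 i h2; lia.
Qed.

End grid.

Section cap_design.
Context {R : realType} {d : nat}.
Local Notation V := 'rV[R]_d.

Lemma grid_floor (eta : R) (v : V) : 0 < eta ->
  enorm (v - \row_i (eta * (Num.floor (v 0 i / eta))%:~R)) <= d%:R * eta.
Proof.
move=> eta0; apply: enorm_le_coord => [|i]; first exact: ltW.
rewrite !mxE.
have /andP[] := floor_itv (v 0 i / eta).
rewrite intrD ler_pdivlMr// ltr_pdivrMr// => h1 h2.
by rewrite ler_norml; apply/andP; split; nra.
Qed.

(** The radius at which the cap around [y / enorm y] is the trace on the sphere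
    of the ball of radius [r] around [y], bounded below by [zeta]. *)
Definition trace_radius (r zeta rho : R) : R :=
  Num.sqrt (Num.max (zeta ^+ 2) ((r ^+ 2 - (1 - rho) ^+ 2) / rho)).

Lemma trace_radius_ge (r zeta rho : R) : 0 <= zeta -> zeta <= trace_radius r zeta rho.
Proof.
move=> z0.
by rewrite -[leLHS]ger0_norm// -sqrtr_sqr ler_wsqrtr// le_max lexx.
Qed.

Lemma sqr_trace_radius (r zeta rho : R) : trace_radius r zeta rho ^+ 2 =
  Num.max (zeta ^+ 2) ((r ^+ 2 - (1 - rho) ^+ 2) / rho).
Proof. by rewrite sqr_sqrtr// le_max sqr_ge0. Qed.

Lemma trace_radius_le (r zeta rho : R) : 0 <= zeta -> zeta <= r ->
  1 / 2 <= rho -> trace_radius r zeta rho <= 2 * r.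
Proof.
move=> z0 zr rho2; rewrite -(@ler_pXn2r _ 2) ?nnegrE ?sqrtr_ge0//; last lra.
rewrite sqr_trace_radius ge_max; apply/andP; split; first by nra.
rewrite ler_pdivrMr; last lra.
by have := sqr_ge0 (1 - rho); nra.
Qed.

Section trace.
Variables (r zeta : R) (y : V).
Let u := (enorm y)^-1 *: y.

(** Together with [ball_of_cap]: the directions in the cap attached to [y] lie
    between the traces on the sphere of the balls of radii [r] and
    [r + 2 * zeta] around [y]. *)
Lemma cap_of_ball v : 0 <= r -> r <= 1 / 2 ->
  unit_sphere v -> enorm (y - v) <= r ->
  `|enorm y - 1| <= r /\ enorm (v - u) <= trace_radius r zeta (enorm y).
Proof.
move=> r0 r2 v1 yv.
have rho1 : `|enorm y - 1| <= r.
  apply: le_trans yv; have := ler_dist_enorm y v; by rewrite (v1 : enorm v = 1).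
split => //; have /andP[h1 h2] : 1 - r <= enorm y <= 1 + r.
  by move: rho1; rewrite ler_norml => /andP[h1 h2]; apply/andP; split; lra.
have y0 : 0 < enorm y by lra.
have u1 : unit_sphere u by apply: normalize_sphere; rewrite gt_eqF.
rewrite -(@ler_pXn2r _ 2) ?nnegrE ?sqrtr_ge0 ?enorm_ge0//.
rewrite sqr_trace_radius le_max; apply/orP; right.
have := sqr_enorm_polar (enorm y) u1 v1.
rewrite /u scalerA mulfV ?gt_eqF// scale1r -/u (enormB v) => e.
rewrite ler_pdivlMr// mulrC -(lerD2l ((1 - enorm y) ^+ 2)) -e.
have : enorm (y - v) ^+ 2 <= r ^+ 2 by rewrite ler_pXn2r ?nnegrE ?enorm_ge0.
lra.
Qed.

Lemma ball_of_cap v : 0 <= r -> r <= 1 / 2 -> 0 <= zeta ->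
  unit_sphere v -> `|enorm y - 1| <= r ->
  enorm (v - u) <= trace_radius r zeta (enorm y) ->
  enorm (y - v) <= r + 2 * zeta.
Proof.
move=> r0 r2 zeta0 v1 rho1 vu.
have /andP[h1 h2] : 1 - r <= enorm y <= 1 + r.
  by move: rho1; rewrite ler_norml => /andP[h1 h2]; apply/andP; split; lra.
have y0 : 0 < enorm y by lra.
have u1 : unit_sphere u by apply: normalize_sphere; rewrite gt_eqF.
have := sqr_enorm_polar (enorm y) u1 v1.
rewrite /u scalerA mulfV ?gt_eqF// scale1r -/u => e.
rewrite -(@ler_pXn2r _ 2) ?nnegrE ?enorm_ge0//; last lra.
rewrite e enormB.
have : enorm (v - u) ^+ 2 <= trace_radius r zeta (enorm y) ^+ 2.
  by rewrite ler_pXn2r ?nnegrE ?sqrtr_ge0 ?enorm_ge0.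
rewrite sqr_trace_radius le_max => /orP[h|].
  have : (1 - enorm y) ^+ 2 <= r ^+ 2 by nra.
  have : enorm y * enorm (v - u) ^+ 2 <= 2 * zeta ^+ 2 by nra.
  by nra.
rewrite ler_pdivlMr// mulrC => h.
by nra.
Qed.

End trace.

(** The constant [M] depends on [eps] alone, so the radii may be taken anywhere in
    a window of bounded ratio at an arbitrarily small scale [zeta]. The mesh
    [zeta / d] makes every point lie within [zeta] of the grid. *)
Lemma cap_design (eps : R) : (0 < d)%N -> 0 < eps ->
  exists2 M : R, 1 <= M & forall zeta : R, 0 < zeta -> M * zeta <= 1 ->
  exists (s : seq (V * R)) (N : nat), [/\ (0 < N)%N,
    forall c, c \in s -> unit_sphere c.1 /\ zeta <= c.2 <= M * zeta &
    forall v, unit_sphere v ->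
      (N <= count (fun c => (enorm (v - c.1) <= c.2)%R) s)%N /\
      (count (fun c => (enorm (v - c.1) <= c.2)%R) s)%:R <= (1 + eps) * N%:R].
Proof.
move=> d0 eps0; have [K hK] := exp_beats_poly eps0 d0.
have K0 := ler0n R K.
exists (4 * (4 * K%:R + 1)) => [|zeta zeta0 Mzeta]; first by lra.
have dR : 0 < d%:R :> R by rewrite ltr0n.
have d1 : 1 <= d%:R :> R by rewrite ler1n.
pose eta := zeta / d%:R.
have eta0 : 0 < eta by rewrite divr_gt0.
have deta : d%:R * eta = zeta by rewrite mulrC divfK ?gt_eqF.
have eta1 : eta <= 1 by nra.
pose L := (Num.truncn (3 / eta)).+1.
have hL : 3 < eta * L%:R by rewrite mulrC -ltr_pdivrMr// truncnS_gt.
pose a j : nat := @grid_count R d eta L 0 (4 * j%:R * zeta).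
(* Radii in steps of [4 * zeta]: one [zeta] is lost on each side when the centre
   [v] is moved to the grid, and [2 * zeta] when small caps are enlarged. *)
have [j jK aj] : exists2 j, (j < K)%N & (a j.+1)%:R <= (1 + eps) * (a j)%:R.
  apply: (@slow_growth _ eps (fun j => (a j)%:R)) => //.
    by rewrite ler1n; apply: grid_count0_gt0; rewrite mulr0 mul0r.
  apply: le_lt_trans hK; rewrite ler_nat.
  rewrite (_ : (8 * K * d).+1 = (4 * K * d).*2.+1)%N; last lia.
  apply: grid_count0_le => //.
  by rewrite !natrM -deta; lra.
have jK' : j%:R + 1 <= K%:R :> R by rewrite natr1 ler_nat.
have j0 := ler0n R j.
pose r := (4 * j%:R + 1) * zeta.
have r0 : 0 <= r by rewrite mulr_ge0 ?ltW//; lra.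
have r4 : r + 4 * zeta <= 1 / 4 + 0 by rewrite /r; nra.
have zr : zeta <= r by rewrite /r; nra.
have L2 : (L.*2%:Z)%:~R = 2 * L%:R :> R by rewrite -pmulrn -muln2 natrM mulrC.
have fl (v : V) (i : 'I_d) : unit_sphere v -> let f := (Num.floor (v 0 i / eta))%:~R : R in
    - 1 - eta <= eta * f <= 1.
  move=> v1 /=; have := ler_coord_enorm v i; rewrite v1 ler_norml => /andP[a1 a2].
  have /andP[] := floor_itv (v 0 i / eta).
  by rewrite intrD ler_pdivlMr// ltr_pdivrMr// => h1 h2; apply/andP; split; nra.
have coordk (k : {ffun 'I_d -> 'I_L.*2.+1}) (v : V) (i : 'I_d) q : enorm (grid_point eta k - v) <= q ->
    `|eta * ((k i)%:R - L%:R) - v 0 i| <= q.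
  by move=> h; have := le_trans (ler_coord_enorm _ i) h; rewrite !mxE.
have low v : unit_sphere v -> (a j <= @grid_count R d eta L v r)%N.
  move=> v1; apply: (@grid_count_shift _ _ _ _ (fun i => Num.floor (v 0 i / eta))) => //.
    move=> k hk i.
    have := coordk _ _ i _ hk; rewrite mxE subr0 ler_norml => /andP[h1 h2].
    have /andP[f1 f2] := fl v i v1.
    rewrite -(ler_int R) -(ler_int R _ L.*2) intrD L2 -pmulrn.
    set fi := (Num.floor _)%:~R in f1 f2 *.
    by apply/andP; split; rewrite -(ler_pM2l eta0) /=; rewrite /r in r4 *; nra.
  rewrite add0r enormB (le_trans (grid_floor _ eta0))// deta /r; lra.
have up v : unit_sphere v -> (@grid_count R d eta L v (r + 2 * zeta) <= a j.+1)%N.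
  move=> v1; apply: (@grid_count_shift _ _ _ _ (fun i => - Num.floor (v 0 i / eta))) => //.
    move=> k hk i.
    have := coordk _ _ i _ hk; rewrite ler_norml => /andP[h1 h2].
    have := ler_coord_enorm v i; rewrite v1 ler_norml => /andP[v1i v2i].
    have /andP[f1 f2] := fl v i v1.
    rewrite -(ler_int R) -(ler_int R _ L.*2) intrD L2 mulrNz -pmulrn.
    set fi := (Num.floor _)%:~R in f1 f2 *.
    by apply/andP; split; rewrite -(ler_pM2l eta0) /=; nra.
  rewrite subr0 (_ : \row_i _ = - \row_i (eta * (Num.floor (v 0 i / eta))%:~R)).
    by rewrite (le_trans (grid_floor _ eta0))// deta /r -natr1; lra.
  by apply/rowP => i; rewrite !mxE mulrNz mulrN.
pose good (k : {ffun 'I_d -> 'I_L.*2.+1}) := `|enorm (grid_point eta k) - 1| <= r.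
pose cp (k : {ffun 'I_d -> 'I_L.*2.+1}) : V * R :=
  ((enorm (grid_point eta k))^-1 *: grid_point eta k,
   trace_radius r zeta (enorm (grid_point eta k))).
exists [seq cp k | k <- enum {ffun 'I_d -> 'I_L.*2.+1} & good k], (a j).
have cnt v : count (fun c => (enorm (v - c.1) <= c.2)%R)
    [seq cp k | k <- enum {ffun 'I_d -> 'I_L.*2.+1} & good k] =
    #|[pred k | (enorm (v - (cp k).1) <= (cp k).2)%R && good k]|.
  by rewrite count_map count_filter cardE [RHS]size_filter enumT; apply: eq_count.
split.
- by apply: grid_count0_gt0; rewrite !mulr_ge0 ?ler0n ?ltW.
- move=> c /mapP[k]; rewrite mem_filter => /andP[gk _] ->.
  move: gk; rewrite /good ler_norml => /andP[g1 g2].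
  split; first by apply: normalize_sphere; rewrite gt_eqF//; lra.
  apply/andP; split; first by rewrite trace_radius_ge ?ltW.
  apply: (le_trans (trace_radius_le (ltW zeta0) zr _)); first lra.
  by rewrite /r; nra.
- move=> v v1; rewrite cnt; split.
    apply: (leq_trans (low v v1)); apply: subset_leq_card.
    apply/fintype.subsetP => k; rewrite !inE => hk.
    have r2 : r <= 1 / 2 by lra.
    have [] := @cap_of_ball r zeta (grid_point eta k) v r0 r2 v1 hk.
    by rewrite /good => -> ->.
  apply: le_trans aj; rewrite ler_nat.
  apply: leq_trans (up v v1); apply: subset_leq_card.
  apply/fintype.subsetP => k; rewrite !inE => /andP[h1 h2].
  by apply: ball_of_cap => //; [lra|exact: ltW].
Qed.

End cap_design.

(** * The tail of the difference *)

Section double_count.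
Context {R : realType} {dT} {T : measurableType dT}.
Variable mu : {finite_measure set T -> \bar R}.
Variables (C : Type) (A : C -> set T) (S : set T).
Hypotheses (mA : forall c, measurable (A c)) (mS : measurable S).
Implicit Types (s : seq C) (N : R).

Lemma sum_measure_count s :
  (\sum_(c <- s) (fine (mu (A c `&` S))))%:E =
  (\int[mu]_(x in S) (count (fun c => `[< A c x >]) s)%:R%:E)%E.
Proof.
rewrite -sumEFin; transitivity (\sum_(c <- s) \int[mu]_(x in S) (\1_(A c) x)%:E)%E.
  apply: eq_bigr => c _; rewrite integral_indic// fineK// fin_num_measure//.
  exact: measurableI.
rewrite -ge0_integral_sum//; last first.
  by move=> c; apply/measurable_EFinP; exact: measurable_indic.
apply: eq_integral => x _; rewrite sumEFin; congr EFin.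
elim: s => [|c s ih]; first by rewrite big_nil.
rewrite big_cons ih /= natrD indicE; congr (_ + _).
Qed.

Let measurable_count s :
  measurable_fun S (fun x => (count (fun c => `[< A c x >]) s)%:R%:E : \bar R).
Proof.
apply/measurable_EFinP.
rewrite (_ : (fun _ => _) = (fun x => \sum_(c <- s) \1_(A c) x)).
  by apply: measurable_sum => c; exact: measurable_indic.
apply/funext => x; elim: s => [|c s ih]; first by rewrite big_nil.
rewrite big_cons -ih /= natrD indicE; congr (_ + _).
Qed.

Let integral_cst_fine N :
  (\int[mu]_(x in S) (cst N%:E) x = (N * fine (mu S))%:E)%E.
Proof. by rewrite integral_cst// EFinM fineK// fin_num_measure. Qed.

(** Fubini for the product of [mu] with the counting measure on [s]. *)
Lemma double_count_ge s N : 0 <= N ->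
  (forall x, S x -> N <= (count (fun c => `[< A c x >]) s)%:R) ->
  N * fine (mu S) <= \sum_(c <- s) fine (mu (A c `&` S)).
Proof.
move=> N0 hN; rewrite -lee_fin sum_measure_count -integral_cst_fine.
exact: ge0_le_integral.
Qed.

Lemma double_count_le s N :
  (forall x, S x -> (count (fun c => `[< A c x >]) s)%:R <= N) ->
  \sum_(c <- s) fine (mu (A c `&` S)) <= N * fine (mu S).
Proof.
move=> hN; rewrite -lee_fin sum_measure_count -integral_cst_fine.
by apply: ge0_le_integral => // x Sx; rewrite /cst lee_fin ?hN// (le_trans _ (hN x Sx)).
Qed.

End double_count.

Lemma ratio_near1_le {R : realType} (eps num den : R) : 0 <= den ->
  ratio_near1 eps num den -> `|num - den| <= eps * den.
Proof.
rewrite /ratio_near1; case: eqVneq => [-> _ ->|den0 den_ge0].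
  by rewrite subrr normr0 mulr0.
have dgt : 0 < den by rewrite lt_def den0.
rewrite -(ler_pM2r dgt) -{2}(ger0_norm den_ge0) -normrM mulrBl mul1r.
by rewrite divfK.
Qed.

Section tail.
Context {R : realType} {d : nat}.
Local Notation V := 'rV[R]_d.
Context {dT} {T : measurableType dT} (P : probability T R) (X : T -> V).
Variables (sigma : {finite_measure set V -> \bar R}).
Variables (gamma delta1 delta2 : R).

(** The upper bound [2] makes the annulus the union of the thick caps with
    parameter [s]; the difference of two points of the ball satisfies it. *)
Definition annulus (s : R) : set T := [set w | 2 - s <= enorm (X w) <= 2].

Lemma measurable_annulus s : coord_measurable X -> measurable (annulus s).
Proof.
move=> mX; rewrite (_ : annulus s =
  [set w | 2 - s <= enorm (X w)] `&` [set w | enorm (X w) <= 2]).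
  by apply: measurableI; apply: measurable_le_set;
    [exact: measurable_cst|exact: measurable_enorm
    |exact: measurable_enorm|exact: measurable_cst].
by apply/seteqP; split => w; rewrite /annulus/=; [move=> /andP[]|move=> []-> ->].
Qed.

Hypotheses (hd : (0 < d)%N) (mX : coord_measurable X).
Hypotheses (hdelta1 : 0 < delta1) (hdelta12 : delta1 < delta2).
Hypothesis hratio : forall eps : R, 0 < eps -> \forall s \near (0 : R)^'+,
    forall (u : V) (z : R), unit_sphere u ->
      s `^ delta2 <= z <= s `^ delta1 ->
      ratio_near1 eps (fine (P (X @^-1` thick_cap s u z)))
        (s `^ gamma * fine (sigma (cap u z))).

Let sigma0 := fine (sigma unit_sphere).

(** Summing the cap asymptotics over a cap design counts every direction almost
    equally often, both for the law of [X] and for [sigma], so the totals over the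
    sphere inherit the ratio of the individual caps. The window of radii
    [s ^ delta2 .. s ^ delta1] has unbounded ratio as [s] tends to [0], hence
    contains [zeta .. M * zeta] with [zeta = s ^ delta2]. *)
Lemma tail_equiv (e : R) : 0 < e -> e <= 1 -> \forall s \near (0 : R)^'+,
  `|fine (P (annulus s)) - s `^ gamma * sigma0| <= 3 * e * (s `^ gamma * sigma0).
Proof.
move=> e0 e1; have [M M1 design] := @cap_design R d e hd e0.
have dd : 0 < delta2 - delta1 by rewrite subr_gt0.
near=> s.
have s0 : 0 < s by near: s; exact: nbhs_right_gt.
have s1 : s <= 1 by near: s; exact: nbhs_right_le.
have sM : s `^ (delta2 - delta1) < M^-1.
  by near: s; apply: (cvgr_lt (0 : R)); [exact: powR_cvg0|rewrite invr_gt0; lra].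
have rat : forall (u : V) (z : R), unit_sphere u ->
      s `^ delta2 <= z <= s `^ delta1 ->
      ratio_near1 e (fine (P (X @^-1` thick_cap s u z)))
        (s `^ gamma * fine (sigma (cap u z))).
  by near: s; exact: hratio.
have sd1 : s `^ delta1 <= 1.
  apply: (@le_trans _ _ (1 `^ delta1)); last by rewrite powR1.
  by apply: ge0_ler_powR; rewrite ?nnegrE// ltW.
have Mz : M * s `^ delta2 <= s `^ delta1.
  rewrite -[delta2](subrK delta1) powRD; last by rewrite (gt_eqF s0) implybT.
  rewrite mulrA ler_piMl ?powR_ge0// -ler_pdivlMl ?mulr1 ?ltW//; lra.
have [c [N [N0 hc cnt]]] := design (s `^ delta2) (powR_gt0 _ s0) (le_trans Mz sd1).
have NR : 0 < N%:R :> R by rewrite ltr0n.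
have sg0 : 0 < s `^ gamma by exact: powR_gt0.
have s2 : s < 2 by lra.
have sumP : \sum_(a <- c) fine (P (X @^-1` thick_cap s a.1 a.2 `&` annulus s)) =
    \sum_(a <- c) fine (P (X @^-1` thick_cap s a.1 a.2)).
  apply: eq_bigr => a _; congr (fine (P _)); apply: setIidl => w.
  by rewrite /preimage/= => /(thick_capE _ _ _ s2)[].
have sumS : \sum_(a <- c) fine (sigma (cap a.1 a.2 `&` unit_sphere)) =
    \sum_(a <- c) fine (sigma (cap a.1 a.2)).
  by apply: eq_bigr => a _; congr (fine (sigma _)); apply: setIidl => x [].
have dir w : annulus s w -> unit_sphere ((enorm (X w))^-1 *: X w).
  by case/andP => h1 h2; apply: normalize_sphere; rewrite gt_eqF//; lra.
have cntP w : annulus s w ->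
    count (fun a => `[< (X @^-1` thick_cap s a.1 a.2) w >]) c =
    count (fun a => (enorm ((enorm (X w))^-1 *: X w - a.1) <= a.2)%R) c.
  move=> aw; apply: eq_count => a; apply/asboolP/idP; rewrite /preimage/=.
    by move=> /(thick_capE _ _ _ s2)[].
  by move=> h; apply/(thick_capE _ _ _ s2); split.
have cntS v : unit_sphere v -> count (fun a => `[< cap a.1 a.2 v >]) c =
    count (fun a => (enorm (v - a.1) <= a.2)%R) c.
  move=> v1; apply: eq_count => a; apply/asboolP/idP; first by case.
  by move=> h; split.
have mP (a : V * R) : measurable (X @^-1` thick_cap s a.1 a.2).
  exact: measurable_preimage_thick_cap.
have mS (a : V * R) : measurable (cap a.1 a.2) by exact: measurable_cap.
have mann := measurable_annulus s mX.
have msph := @measurable_unit_sphere R d.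
have P1 : N%:R * fine (P (annulus s)) <=
    \sum_(a <- c) fine (P (X @^-1` thick_cap s a.1 a.2)).
  rewrite -sumP; apply: double_count_ge => // w aw.
  by rewrite (cntP w aw) ler_nat; have [] := cnt _ (dir w aw).
have P2 : \sum_(a <- c) fine (P (X @^-1` thick_cap s a.1 a.2)) <=
    (1 + e) * N%:R * fine (P (annulus s)).
  rewrite -sumP; apply: double_count_le => // w aw.
  by rewrite (cntP w aw); have [] := cnt _ (dir w aw).
have S1 : N%:R * sigma0 <= \sum_(a <- c) fine (sigma (cap a.1 a.2)).
  rewrite -sumS; apply: double_count_ge => // v v1.
  by rewrite (cntS v v1) ler_nat; have [] := cnt _ v1.
have S2 : \sum_(a <- c) fine (sigma (cap a.1 a.2)) <= (1 + e) * N%:R * sigma0.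
  rewrite -sumS; apply: double_count_le => // v v1.
  by rewrite (cntS v v1); have [] := cnt _ v1.
have PS : `|\sum_(a <- c) fine (P (X @^-1` thick_cap s a.1 a.2)) -
    s `^ gamma * \sum_(a <- c) fine (sigma (cap a.1 a.2))| <=
    e * (s `^ gamma * \sum_(a <- c) fine (sigma (cap a.1 a.2))).
  rewrite !mulr_sumr -sumrB; apply: (le_trans (ler_norm_sum _ _ _)).
  rewrite big_seq [leRHS]big_seq; apply: ler_sum => a ac.
  have [a1 /andP[a2 a3]] := hc a ac.
  apply: ratio_near1_le; first by rewrite mulr_ge0 ?(ltW sg0) ?fine_ge0.
  by apply: rat => //; rewrite a2 (le_trans a3).
move: PS; rewrite ler_norml => /andP[PS1 PS2].
set SP := \sum_(a <- c) fine (P _) in P1 P2 PS1 PS2.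
set SS := \sum_(a <- c) fine (sigma _) in S1 S2 PS1 PS2.
have sig0 : 0 <= sigma0 by exact: fine_ge0.
have p0 : 0 <= fine (P (annulus s)) by exact: fine_ge0.
set p := fine _ in P1 P2 p0 *.
have up : p <= (1 + e) ^+ 2 * (s `^ gamma * sigma0).
  rewrite -(ler_pM2l NR); apply: (le_trans P1).
  have : s `^ gamma * SS <= s `^ gamma * ((1 + e) * N%:R * sigma0).
    by rewrite ler_pM2l.
  by nra.
have lo : (1 - e) * (s `^ gamma * sigma0) <= (1 + e) * p.
  rewrite -(ler_pM2l NR).
  have : s `^ gamma * (N%:R * sigma0) <= s `^ gamma * SS by rewrite ler_pM2l.
  by nra.
have q0 : 0 <= s `^ gamma * sigma0 by rewrite mulr_ge0 ?(ltW sg0).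
set q := _ * sigma0 in up lo q0 *.
by rewrite ler_norml; apply/andP; split; nra.
Unshelve. all: by end_near. Qed.

End tail.

(** * Graphs with independently active vertices *)

Section active_sets.
Context {R : realType} {I : finType} (p : I -> R).
Implicit Types (b T W : {set I}) (Q : pred {set I}) (i j v : I).

Definition active_weight b : R := \prod_i (if i \in b then p i else 1 - p i).

(** [active_prob Q] is the probability that the random set containing each
    index [i] independently with probability [p i] satisfies [Q]. *)
Definition active_prob Q : R := \sum_(b | Q b) active_weight b.

Lemma active_probT : active_prob predT = 1.
Proof.
rewrite /active_prob /active_weight -bigA_distr big1// => i _.
by rewrite /= addrC subrK.
Qed.

Lemma active_prob_split Q Q' :
  active_prob Q = active_prob (predI Q Q') + active_prob (predI Q (predC Q')).
Proof. by rewrite /active_prob (bigID Q'). Qed.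

(** Adding [v] to a set that does not contain it multiplies its weight by
    [p v / (1 - p v)]. *)
Lemma active_prob_toggle Q v :
  (1 - p v) * active_prob [pred b : {set I} | Q b && (v \in b)] =
  p v * active_prob [pred b : {set I} | (v \notin b) && Q (v |: b)%SET].
Proof.
rewrite /active_prob !mulr_sumr.
rewrite (reindex_onto (fun b => v |: b)%SET (fun b => b :\ v)%SET)/=; last first.
  by move=> b /andP[_ vb]; rewrite finset.setD1K.
apply: eq_big => [b|b].
  rewrite setU11 andbT andbC; case: (boolP (v \in b)) => vb.
    rewrite finset.setUC finset.setDUl finset.setDv finset.setU0.
    apply/negbTE; rewrite negb_and; apply/orP; left.
    by apply/eqP => h; move: vb; rewrite -h !inE eqxx.
  by rewrite setU1K// eqxx.
move=> /andP[_ /eqP vb].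
have {}vb : v \notin b by rewrite -vb !inE eqxx.
rewrite /active_weight (bigD1 v)//= setU11 [in RHS](bigD1 v)//= (negbTE vb).
rewrite mulrCA; congr (_ * (_ * _)); apply: eq_bigr => i iv.
by rewrite !inE (negbTE iv).
Qed.

Hypothesis p01 : forall i, 0 <= p i <= 1.

Lemma active_weight_ge0 b : 0 <= active_weight b.
Proof.
by apply: prodr_ge0 => i _; case: ifP => _; have := p01 i; lra.
Qed.

Lemma active_prob_ge0 Q : 0 <= active_prob Q.
Proof. by apply: sumr_ge0 => b _; exact: active_weight_ge0. Qed.

Lemma active_prob_le Q Q' : (forall b, Q b -> Q' b) ->
  active_prob Q <= active_prob Q'.
Proof.
move=> QQ'; rewrite [leRHS](active_prob_split _ Q).
rewrite (_ : active_prob (predI Q' Q) = active_prob Q).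
  by rewrite lerDl active_prob_ge0.
by apply: eq_bigl => b /=; case: (boolP (Q b)) => [/QQ'->|]; rewrite ?andbF.
Qed.

Let active_prob_in Q v :
  active_prob [pred b : {set I} | Q b && (v \in b)] =
  p v * (active_prob [pred b : {set I} | Q b && (v \in b)]
         + active_prob [pred b : {set I} | (v \notin b) && Q (v |: b)%SET]).
Proof. by have := active_prob_toggle Q v; lra. Qed.

(** The one-site case of the Harris inequality. *)
Lemma active_prob_decr Q v : (forall b, Q (v |: b)%SET -> Q b) ->
  active_prob [pred b : {set I} | Q b && (v \in b)] <= p v * active_prob Q.
Proof.
move=> dQ; rewrite active_prob_in ler_wpM2l//; first by have /andP[] := p01 v.
rewrite [leRHS](active_prob_split Q [pred b : {set I} | v \in b]) lerD2l.
by apply: active_prob_le => b /= /andP[-> /dQ->].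
Qed.

Lemma active_prob_indep Q v : (forall b, Q (v |: b)%SET = Q b) ->
  active_prob [pred b : {set I} | Q b && (v \in b)] = p v * active_prob Q.
Proof.
move=> dQ; rewrite active_prob_in; congr (_ * _).
rewrite [RHS](active_prob_split Q [pred b : {set I} | v \in b]); congr (_ + _).
by apply: eq_bigl => b /=; rewrite dQ andbC.
Qed.

Definition avoids W : pred {set I} := [pred b : {set I} | [disjoint W & b]].

(** A union bound over [W], with the intersections controlled by the one-site
    Harris inequality. *)
Lemma active_prob_avoid Q W : (forall v b, Q (v |: b)%SET -> Q b) ->
  (1 - \sum_(j in W) p j) * active_prob Q <= active_prob (predI Q (avoids W)).
Proof.
move=> dQ; rewrite mulrBl mul1r {1}(active_prob_split Q (avoids W)).
suff : active_prob (predI Q (predC (avoids W))) <=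
    (\sum_(j in W) p j) * active_prob Q by lra.
rewrite mulr_suml.
apply: (@le_trans _ _ (\sum_(j in W) active_prob [pred b : {set I} | Q b && (j \in b)])).
  rewrite /active_prob (exchange_big_dep (predI Q (predC (avoids W))))/=; last first.
    move=> i b iW /andP[-> ib]; apply/pred0Pn; exists i.
    by rewrite /= iW ib.
  apply: ler_sum => b /andP[Qb /pred0Pn[j /= /andP[jW jb]]].
  rewrite (bigD1 j)/=; last by rewrite jW Qb jb.
  by rewrite lerDl; apply: sumr_ge0 => *; exact: active_weight_ge0.
by apply: ler_sum => j _; apply: active_prob_decr => b; exact: dQ.
Qed.

Lemma active_prob_sum_disjoint (Q : I -> pred {set I}) Q' W :
  (forall j b, j \in W -> Q j b -> Q' b) ->
  (forall i j b, Q i b -> Q j b -> i \in W -> j \in W -> i = j) ->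
  \sum_(j in W) active_prob (Q j) <= active_prob Q'.
Proof.
move=> QQ' Qinj; rewrite /active_prob (exchange_big_dep Q')/=; last first.
  by move=> i b; exact: QQ'.
apply: ler_sum => b _.
have [j /andP[jW Qj]|no] := pickP (fun j => (j \in W) && Q j b); last first.
  by rewrite big_pred0// active_weight_ge0.
rewrite (big_pred1 j)// => i /=; apply/idP/eqP => [/andP[iW Qi]|->].
  exact: Qinj Qi Qj iW jW.
by rewrite jW.
Qed.

End active_sets.

Section stable_sets.
Context {R : realType} {I : finType} (p : I -> R) (e : rel I).
Hypothesis p01 : forall i, 0 <= p i <= 1.
Hypothesis esym : symmetric e.
Hypothesis eirr : irreflexive e.
Implicit Types (b T W : {set I}) (i j v : I).

Definition stable T : pred {set I} :=
  [pred b : {set I} | [forall i in T, forall j in T, ~~ [&& i \in b, j \in b & e i j]]].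

Lemma stableP T b : reflect
  (forall i j, i \in T -> j \in T -> i \in b -> j \in b -> ~~ e i j)
  (stable T b).
Proof.
apply: (iffP forall_inP) => [h i j iT jT ib jb|h i iT].
  by have /forall_inP/(_ j jT) := h i iT; rewrite ib jb.
by apply/forall_inP => j jT; apply/and3P => -[ib jb]; apply/negP/h.
Qed.

Let F T : R := active_prob p (stable T).
Let nb v T : {set I} := [set j in T | e v j]%SET.

Let stable_decr T v b : stable T (v |: b)%SET -> stable T b.
Proof.
move=> /stableP h; apply/stableP => i j iT jT ib jb.
by apply: h => //; rewrite !inE ?ib ?jb orbT.
Qed.

Let stable_insensitive T v b : v \notin T -> stable T (v |: b)%SET = stable T b.
Proof.
move=> vT; apply/idP/idP => [|/stableP h]; first exact: stable_decr.
apply/stableP => i j iT jT; rewrite !inE.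
case: eqVneq => [iv|_ /=]; first by rewrite -iv iT in vT.
by case: eqVneq => [jv|_ /= ib jb]; [rewrite -jv jT in vT|exact: h].
Qed.

Let stable_subset T T' b : T \subset T' -> stable T' b -> stable T b.
Proof.
move=> /fintype.subsetP TT' /stableP h; apply/stableP => i j iT jT.
by apply: h; exact: TT'.
Qed.

Let avoids_insensitive W v b : v \notin W -> avoids W (v |: b)%SET = avoids W b.
Proof.
move=> vW; have memE x : (x \in W) && (x \in v |: b)%SET = (x \in W) && (x \in b).
  by rewrite !inE; case: eqVneq => // ->; rewrite (negbTE vW).
by apply/pred0P/pred0P => h x; have := h x; rewrite /= memE.
Qed.

(** The event that [v] creates the first edge splits off exactly, because the
    activity of [v] is independent of that of the other vertices. *)
Lemma stable_prob_step T v : v \notin T ->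
  F (v |: T)%SET =
  F T - p v * active_prob p (predI (stable T) (predC (avoids (nb v T)))).
Proof.
move=> vT; set Q := predI _ _.
have nbT : nb v T \subset T.
  by apply/fintype.subsetP => j; rewrite inE => /andP[].
have vnb : v \notin nb v T by rewrite inE (negbTE vT).
have Qv b : Q (v |: b)%SET = Q b.
  by rewrite /Q /= stable_insensitive//; congr (_ && ~~ _); exact: avoids_insensitive.
rewrite -(active_prob_indep p Qv).
set B := [pred b | _].
rewrite /F [active_prob p (stable T)](active_prob_split p _ B).
have -> : active_prob p (predI (stable T) B) = active_prob p B.
  by apply: eq_bigl => b; rewrite /B/Q/=; case: (stable T b).
rewrite addrC addKr; apply: eq_bigl => b; rewrite /B /Q/=.
apply/idP/idP.
  move=> st; rewrite (stable_subset _ st) ?finset.subsetUr//=.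
  apply/negP => /andP[/pred0Pn[j /= /andP[]]]; rewrite inE => /andP[jT vj] jb vb.
  move/stableP: st => /(_ v j); rewrite setU11 !inE jT orbT vb jb vj.
  by move=> /(_ isT isT isT isT).
move=> /andP[/stableP st nQ]; apply/stableP => i j.
have stT := introT (stableP _ _) st.
have key k : k \in T -> k \in b -> v \in b -> ~~ e v k.
  move=> kT kb vb; apply/negP => vk; move/negP: nQ; apply.
  rewrite stT vb andbT /=; apply/pred0Pn; exists k => /=.
  by rewrite inE kT vk kb.
rewrite !inE => /orP[/eqP->|iT] /orP[/eqP->|jT] ib jb.
- by rewrite eirr.
- exact: key.
- by rewrite esym; exact: key.
- exact: st.
Qed.

Variable delta : R.
Hypothesis degp : forall v, \sum_(j | e v j) p j <= delta.

Let p_ge0 i : 0 <= p i. Proof. by have /andP[] := p01 i. Qed.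

Let sum_nb_le v T : \sum_(j in nb v T) p j <= delta.
Proof.
apply: le_trans (degp v).
rewrite [leRHS](bigID (mem (nb v T)))/=.
rewrite [X in _ <= X + _](_ : _ = \sum_(j in nb v T) p j).
  by rewrite lerDl sumr_ge0.
by apply: eq_bigl => j; rewrite inE; case: (e v j); rewrite ?andbF.
Qed.

(** Upper and lower bounds, here and in [stable_hit_ge], for the probability that
    [T] has no active edge while some neighbour of [v] is active: it is close to
    what independence of the two events would give. *)
Lemma stable_hit_le T v :
  active_prob p (predI (stable T) (predC (avoids (nb v T)))) <=
  (\sum_(j in nb v T) p j) * F T.
Proof.
have := active_prob_avoid p01 (nb v T) (stable_decr (T := T)).
rewrite /F [X in _ * X <= _](active_prob_split p (stable T) (avoids (nb v T))).
by rewrite [X in _ <= _ * X](active_prob_split p (stable T) (avoids (nb v T))); lra.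
Qed.

(** Keeping only the event that exactly one neighbour [j] of [v] is active makes
    the union over [j] disjoint; given that [j] is active, all that remains is to
    keep the other neighbours of [v] and those of [j] inactive. *)
Lemma stable_hit_ge T v : delta <= 1 / 2 ->
  (1 - 2 * delta) * (\sum_(j in nb v T) p j) * F T <=
  active_prob p (predI (stable T) (predC (avoids (nb v T)))).
Proof.
move=> d2; pose W j := ((nb v T :|: nb j T) :\ j)%SET.
pose Q j : pred {set I} :=
  [pred b : {set I} | (stable (T :\ j)%SET b && avoids (W j) b) && (j \in b)].
apply: le_trans (_ : \sum_(j in nb v T) active_prob p (Q j) <= _); last first.
  apply: active_prob_sum_disjoint => // [j b jv|i j b].
    rewrite /Q/= => /andP[/andP[/stableP st /pred0P av] jb].
    have {}av k : k \in b -> k != j -> (k \notin nb v T) /\ (k \notin nb j T).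
      move=> kb kj; have := av k; rewrite /= inE kb andbT !inE kj /= => /negbT.
      by rewrite negb_or => /andP[].
    apply/andP; split; last first.
      by apply/pred0Pn; exists j => /=; rewrite jv jb.
    have key k : k \in T -> k \in b -> ~~ e j k.
      move=> kT kb; have [->|kj] := eqVneq k j; first by rewrite eirr.
      by have [_] := av k kb kj; rewrite inE kT.
    apply/stableP => i k iT kT ib kb.
    have [->|ij] := eqVneq i j; first exact: key.
    have [->|kj] := eqVneq k j; first by rewrite esym key.
    by apply: st => //; rewrite !inE ?ij ?kj.
  rewrite /Q/= => /andP[/andP[_ /pred0P avi] ib] /andP[/andP[_ /pred0P avj] jb].
  move=> iv jv; apply/eqP/negPn/negP => ij.
  by move: iv; rewrite inE => iv; have := avj i; rewrite /= !inE ib ij iv.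
rewrite mulrAC mulr_sumr; apply: ler_sum => j _.
rewrite (active_prob_indep p (Q := predI (stable (T :\ j)%SET) (avoids (W j)))).
  rewrite [leRHS]mulrC ler_wpM2r//.
  apply: le_trans (active_prob_avoid p01 (W j) _); last first.
    by move=> w b; exact: stable_decr.
  have FT : F T <= active_prob p (stable (T :\ j)%SET).
    by apply: active_prob_le => // b; apply: stable_subset; exact: subsetDl.
  have F0 : 0 <= F T by exact: active_prob_ge0.
  have W2 : \sum_(i in W j) p i <= 2 * delta.
    have -> : 2 * delta = delta + delta by lra.
    apply: le_trans (lerD (sum_nb_le v T) (sum_nb_le j T)).
    rewrite [leRHS](_ : _ = \sum_i ((if i \in nb v T then p i else 0) +
       (if i \in nb j T then p i else 0))); last first.
      by rewrite big_split/= -!big_mkcond.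
    rewrite big_mkcond; apply: ler_sum => i _.
    rewrite !inE; have := p_ge0 i.
    by case: (i \in T); case: (e v i); case: (e j i); case: (i == j) => /=; lra.
  by apply: ler_pM => //; lra.
move=> b /=; rewrite stable_insensitive; last by rewrite !inE eqxx.
by rewrite [X in _ && X]avoids_insensitive// !inE eqxx.
Qed.

(** Each unordered edge appears twice in the sum, hence the factor [1 / 2]: this is
    the expected number of active edges inside [T]. *)
Definition edge_mass T : R :=
  (\sum_(i in T) \sum_(j in T | e i j) p i * p j) / 2.

Lemma edge_mass_step T v : v \notin T ->
  edge_mass (v |: T)%SET = edge_mass T + p v * (\sum_(j in nb v T) p j).
Proof.
move=> vT; rewrite /edge_mass big_setU1//=.
have split i : \sum_(j in (v |: T)%SET | e i j) p i * p j =
    (if e i v then p i * p v else 0) + \sum_(j in T | e i j) p i * p j.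
  by rewrite big_mkcondr big_setU1//= -big_mkcondr.
rewrite split eirr add0r (eq_bigr _ (fun i _ => split i)) big_split/=.
rewrite -[in X in (_ + (X + _)) / 2]big_mkcondr.
have -> : \sum_(i in T | e i v) p i * p v = \sum_(j in T | e v j) p v * p j.
  by apply: eq_big => [i|i _]; rewrite ?(esym i)// mulrC.
have -> : \sum_(j in T | e v j) p v * p j = p v * (\sum_(j in nb v T) p j).
  by rewrite mulr_sumr; apply: eq_bigl => j; rewrite inE.
lra.
Qed.

(** By induction on the vertex set: adding [v] multiplies the probability by a
    factor between [1 - x] and [1 - (1 - 2 * delta) * x], where [x], the expected
    number of active edges at [v], is at most [delta]. *)
Lemma stable_prob_bounds : 0 <= delta < 1 / 2 ->
  expR (- (edge_mass finset.setT / (1 - delta))) <= active_prob p (stable finset.setT)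
  <= expR (- ((1 - 2 * delta) * edge_mass finset.setT)).
Proof.
move=> /andP[d0 d2]; rewrite -/(F finset.setT).
have d1 : 0 < 1 - delta by lra.
move: (finset.setT : {set I}) => T; have [n] := ubnP #|T|.
elim: n T => // n ih T; rewrite ltnS => Tn.
have [->|/set0Pn[v vT]] := eqVneq T finset.set0.
  have -> : edge_mass finset.set0 = 0 by rewrite /edge_mass big_set0 mul0r.
  rewrite mul0r mulr0 oppr0 expR0 (_ : F _ = 1) ?lexx//.
  rewrite -(active_probT p); apply: eq_bigl => b.
  by apply/stableP => i j; rewrite inE.
have Sn : (#|(T :\ v)%SET| < n)%N by move: Tn; rewrite (cardsD1 v T) vT.
rewrite -(finset.setD1K vT); have := setD11 v T; move: Sn.
move: (T :\ v)%SET => S /ih/andP[lo up] /negbT vS.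
rewrite stable_prob_step// edge_mass_step//.
have h1 := stable_hit_le S v; have h2 := stable_hit_ge S v (ltW d2).
set A := active_prob p _ in h1 h2 *.
have q0 : 0 <= \sum_(j in nb v S) p j by exact: sumr_ge0.
have qd := sum_nb_le v S.
set q := \sum_(j in _) _ in h1 h2 q0 qd *.
have /andP[p0 p1] := p01 v.
have F0 : 0 <= F S by exact: active_prob_ge0.
set x := p v * q.
have x0 : 0 <= x by rewrite mulr_ge0.
have xd : x <= delta by rewrite /x; nra.
rewrite mulrDl mulrDr !opprD !expRD; apply/andP; split.
  apply: (@le_trans _ _ ((1 - x) * F S)); last by rewrite /x; nra.
  rewrite mulrC ler_pM ?expR_ge0//.
  have y0 : 0 <= x / (1 - delta) by rewrite divr_ge0// ltW.
  rewrite expRN -[leRHS]invrK lef_pV2 ?posrE ?expR_gt0 ?invr_gt0//; last lra.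
  apply: le_trans (expR_ge1Dx _).
  rewrite -[leLHS]mul1r ler_pdivrMr; last lra.
  have : x / (1 - delta) * (1 - delta) = x by rewrite divfK// gt_eqF.
  by nra.
apply: (@le_trans _ _ (F S * (1 - (1 - 2 * delta) * x))).
  by rewrite /x; nra.
apply: ler_pM => //; first by nra.
by apply: le_trans (expR_ge1Dx _); rewrite addrC.
Qed.

End stable_sets.

(** * Occupied cells of a Poisson process *)

Section finite_unions.
Context {R : realType} {dT} {T : measurableType dT} {I : finType}.
Implicit Types (D : pred I) (A : I -> set T).

Lemma measurable_finU D A : (forall i, D i -> measurable (A i)) ->
  measurable (\bigcup_(i in [set` D]) A i).
Proof.
by move=> mA; apply: fin_bigcup_measurable => [|i /mA//]; exact: finite_finset.
Qed.

Lemma measure_finU (mu : {measure set T -> \bar R}) D A :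
  (forall i, D i -> measurable (A i)) -> trivIset [set` D] A ->
  mu (\bigcup_(i in [set` D]) A i) = (\sum_(i | D i) mu (A i))%E.
Proof.
move=> mA tA; have DE : [set` D] = [set` enum D].
  by apply/seteqP; split => i /=; rewrite mem_enum.
rewrite measure_fin_bigcup; [|exact: finite_finset|by []|by []].
rewrite DE -fsbig_seq ?enum_uniq// big_enum_cond/=.
by apply: eq_bigl => i; rewrite andbT.
Qed.

End finite_unions.

Section poisson_activity.
Context {R : realType} {dO} {Omega : measurableType dO} (P : probability Omega R).
Context {dT} {T : measurableType dT} (Lambda : {measure set T -> \bar R}).
Variables (Pi : Omega -> seq T) (hPi : poisson_process P Lambda Pi).

Lemma measurable_void A : measurable A ->
  measurable [set w | points_in (Pi w) A = 0%N].
Proof.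
move=> mA; have := pp_measurable hPi mA measurableT (Y := [set 0%N]) I.
by rewrite setTI.
Qed.

Lemma void_prob A : measurable A ->
  P [set w | points_in (Pi w) A = 0%N] = (expR (- fine (Lambda A)))%:E.
Proof.
move=> mA; rewrite (pp_poisson hPi mA [set 0%N]) /poisson_prob.
have L0 : 0 <= fine (Lambda A) by exact: fine_ge0.
case: ifPn => [L1|].
  rewrite esum_set1 ?lee_fin ?poisson_pmf_ge0// /poisson_pmf L1.
  by rewrite expr0 fact0 invr1 !mul1r.
rewrite -leNgt => L1; have -> : fine (Lambda A) = 0 by apply/eqP; rewrite eq_le L1.
by rewrite diracE mem_set// oppr0 expR0.
Qed.

Context {I : finType} (Q : I -> set T).
Hypotheses (mQ : forall i, measurable (Q i)) (tQ : trivIset setT Q).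
Implicit Types (b c : {set I}) (G : pred {set I}) (i v : I).

Definition active_cells (w : Omega) : {set I} :=
  [set i | points_in (Pi w) (Q i) != 0%N]%SET.

Let p i : R := 1 - expR (- fine (Lambda (Q i))).

Lemma points_in_eq0 (s : seq T) (A : set T) :
  points_in s A = 0%N <-> ~ has (fun x => `[< A x >]) s.
Proof. by rewrite /points_in has_count lt0n; split => [->|/negP/negPn/eqP]. Qed.

Lemma measurable_active G : measurable [set w | G (active_cells w)].
Proof.
rewrite (_ : [set w | G (active_cells w)] =
    \bigcup_(b in [set` G]) [set w | active_cells w = b]); last first.
  by apply/seteqP; split => w /=; [move=> Gw; exists (active_cells w)|by move=> [b /= Gb ->]].
apply: measurable_finU => b _.
rewrite (_ : [set w | active_cells w = b] =
    \bigcap_(i in [set: I]) [set w | (i \in active_cells w) = (i \in b)]); last first.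
  apply/seteqP; split => w /=; first by move=> wb i _ /=; rewrite wb.
  by move=> h; apply/setP => i; exact: h.
apply: fin_bigcap_measurable => [|i _]; first exact: finite_finset.
have mV := measurable_void (mQ i).
have [ib|ib] := boolP (i \in b).
  suff -> : [set w | (i \in active_cells w) = true] =
      ~` [set w | points_in (Pi w) (Q i) = 0%N] by exact: measurableC.
  by apply/seteqP; split => w /=; rewrite inE; [move/eqP|move/eqP].
suff -> : [set w | (i \in active_cells w) = false] =
    [set w | points_in (Pi w) (Q i) = 0%N] by [].
by apply/seteqP; split => w /=; rewrite inE; [move/negbT/negPn/eqP|move=> ->].
Qed.

Let cyl b c : pred {set I} := [pred a : {set I} | (b \subset a) && [disjoint c & a]].

(** Induction on [b]: an occupied cell [v] is removed from [b] by subtracting the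
    case in which it is void, so that only void events remain; these have the
    required product form because the intensity is additive. *)
Lemma active_cylinder b c : [disjoint b & c]%B ->
  P [set w | cyl b c (active_cells w)] =
  ((\prod_(i in b) p i) * \prod_(i in c) (1 - p i))%:E.
Proof.
have [n] := ubnP #|b|; elim: n b c => // n ih b c; rewrite ltnS => bn bc.
have [->|/set0Pn[v vb]] := eqVneq b finset.set0.
  rewrite big_set0 mul1r.
  rewrite (_ : [set w | cyl finset.set0 c (active_cells w)] =
    [set w | points_in (Pi w) (\bigcup_(i in [set` c]) Q i) = 0%N]); last first.
    apply/seteqP; split => w /=; rewrite /cyl/= finset.sub0set /= points_in_eq0.
      move=> /pred0P h /hasP[x xw /asboolP[i /= ic Qx]].
      have := h i; rewrite /= ic inE /= => /negbFE/eqP/points_in_eq0; apply.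
      by apply/hasP; exists x => //; exact/asboolP.
    move=> h; apply/pred0P => i /=; apply/negP => /andP[ic]; rewrite inE => /eqP; apply.
    apply/points_in_eq0 => /hasP[x xw /asboolP Qx]; apply: h; apply/hasP.
    by exists x => //; apply/asboolP; exists i.
  rewrite void_prob; last exact: measurable_finU.
  rewrite measure_finU//; last exact: sub_trivIset tQ.
  have fin i : Lambda (Q i) \is a fin_num.
    rewrite ge0_fin_numE//; apply: le_lt_trans (pp_finite hPi).
    by apply: le_measure; rewrite ?inE.
  rewrite -sum_fine// -sumrN expR_sum; congr EFin.
  by apply: eq_bigr => i _; rewrite /p opprB addrC subrK.
have vc : v \notin c.
  by apply/negP => vc; move/pred0P: bc => /(_ v); rewrite /= vb vc.
set b' := (b :\ v)%SET.
have b'n : (#|b'| < n)%N by move: bn; rewrite (cardsD1 v b) vb.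
have b'c : [disjoint b' & c]%B.
  by apply: fintype.disjointWl bc; exact: finset.subsetDl.
have b'vc : [disjoint b' & (v |: c)%SET]%B.
  apply/pred0P => i /=; rewrite !inE; case: eqVneq => //= _.
  by move/pred0P: bc => /(_ i).
pose E b c := [set w | cyl b c (active_cells w)].
have mE b1 c1 : measurable (E b1 c1) by exact: measurable_active.
have splitE : E b' c = E b c `|` E b' (v |: c)%SET.
  apply/seteqP; split => w; rewrite /E/cyl/=.
    move=> /andP[b'a ca]; case: (boolP (v \in active_cells w)) => va.
      left; rewrite ca andbT; apply/fintype.subsetP => i ib.
      have [->//|iv] := eqVneq i v.
      by move/fintype.subsetP: b'a; apply; rewrite !inE iv.
    right; rewrite b'a /=; apply/pred0P => i /=; rewrite in_setU1.
    case: eqVneq => [->|_ /=]; first by rewrite (negbTE va).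
    by move/pred0P: ca => /(_ i).
  move=> [|] /andP[h1 h2]; apply/andP; split => //.
  - by apply: fintype.subset_trans h1; exact: finset.subsetDl.
  - by apply: fintype.disjointWl h2; exact: finset.subsetUr.
have disjE : E b c `&` E b' (v |: c)%SET = set0.
  apply/seteqP; split => w //=.
  rewrite /E/cyl/= => -[/andP[ba _] /andP[_ /pred0P/(_ v)]].
  by rewrite /= setU11 (fintype.subsetP ba v vb).
have : (P (E b' c) = P (E b c) + P (E b' (v |: c)%SET))%E.
  by rewrite splitE; exact: measureU.
rewrite {1}/E (ih b' c b'n b'c) {2}/E (ih b' (v |: c)%SET b'n b'vc) big_setU1//=.
rewrite -/(E b c) -(fineK (fin_num_measure P _ (mE b c))).
rewrite -EFinD => -[/eqP]; rewrite -subr_eq => /eqP <-.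
rewrite (big_setD1 v vb) /= -/b'; congr EFin; ring.
Qed.

(** Void probabilities alone determine the law of the set of occupied cells:
    occupied cells are complements of void ones. *)
Lemma active_cells_prob G :
  P [set w | G (active_cells w)] = (active_prob p G)%:E.
Proof.
rewrite (_ : [set w | G (active_cells w)] =
    \bigcup_(b in [set` G]) [set w | cyl b (~: b)%SET (active_cells w)]); last first.
  apply/seteqP; split => w /=.
    move=> Gw; exists (active_cells w) => //=.
    rewrite /cyl/= fintype.subxx; apply/pred0P => i /=.
    by rewrite finset.in_setC; case: (_ \in _).
  move=> [b /= Gb /andP[h1 h2]]; rewrite (_ : active_cells w = b)//.
  apply/eqP; rewrite finset.eqEsubset h1 andbT; apply/fintype.subsetP => i ia.
  apply/negPn/negP => ib; move/pred0P: h2 => /(_ i) /=.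
  by rewrite ia finset.in_setC ib.
rewrite measure_finU.
- rewrite -sumEFin; apply: eq_bigr => b _; apply: (etrans (active_cylinder _)).
    by apply/pred0P => i /=; rewrite finset.in_setC andbN.
  congr EFin; rewrite /active_weight [RHS](bigID (mem b))/=; congr (_ * _).
    by apply: eq_bigr => i ->.
  apply: eq_big => [i|i]; first by rewrite finset.in_setC.
  by rewrite finset.in_setC => /negbTE ->.
- by move=> b _; exact: measurable_active.
- move=> b c _ _ [w [/andP[h1 h2] /andP[h3 h4]]].
  suff key b' c' : b' \subset active_cells w -> [disjoint (~: c')%SET & active_cells w]%B ->
      b' \subset c'.
    by apply/eqP; rewrite finset.eqEsubset (key b c h1 h4) (key c b h3 h2).
  move=> /fintype.subsetP ha /pred0P hd; apply/fintype.subsetP => i ib.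
  apply/negPn/negP => ic; have := hd i.
  by rewrite /= finset.in_setC ic ha.
Qed.

End poisson_activity.

(** * Far pairs of points *)

Section far_pairs.
Context {R : realType} {d : nat}.
Local Notation V := 'rV[R]_d.
Implicit Types (s : seq V) (r eta : R) (k l : {ffun 'I_d -> int}) (x y : V).

Definition has_far_pair r s := exists x y, [/\ x \in s, y \in s & r <= enorm (x - y)].

(** The supremum over finitely many pairs is attained; positivity of [r] excludes
    the empty configuration, whose diameter is [0]. *)
Lemma has_far_pair_diam r s : 0 < r -> has_far_pair r s <-> r <= diam [set` s].
Proof.
move=> r0; pose D := [set enorm (xy.1 - xy.2) | xy in [set` s] `*` [set` s]].
pose m := \big[Num.max/0]_(xy <- [seq (x, y) | x <- s, y <- s]) enorm (xy.1 - xy.2).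
have Dm : ubound D m.
  move=> _ [[x y] [/= xs ys] <-]; apply: (@le_bigmax_seq _ R (V * V)%type _ 0 (x, y)) => //.
  exact: allpairs_f.
split=> [[x [y [xs ys xy]]]|rd].
  apply: (le_trans xy); apply: ub_le_sup; first by exists m.
  by exists (x, y).
apply: contrapT => no.
have mr : m < r.
  rewrite /m big_seq; apply: (big_ind (fun z => z < r)) => // [a b ar br|xy].
    by rewrite gt_max ar br.
  move=> /allpairsP[[x y] [/= xs ys ->]] /=.
  by rewrite ltNge; apply/negP => h; apply: no; exists x, y.
move: rd; apply/negP; rewrite -ltNge; apply: le_lt_trans mr.
have [D0|/set0P/negP/negPn/eqP D0] := pselect (D !=set0).
  exact: ge_sup.
rewrite /diam -/D D0 sup0; apply: bigmax_ge_id.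
Qed.

(** The cells are indexed by all integer vectors here, since measurability of the
    event of a far pair concerns the configuration in the whole space. *)
Definition cell eta k : set V :=
  [set x | forall i, eta * (k i)%:~R <= x 0 i < eta * (k i)%:~R + eta].

Lemma measurable_cell eta k : measurable (cell eta k).
Proof.
rewrite (_ : cell eta k = \bigcap_(i in [set: 'I_d])
  ([set x : V | eta * (k i)%:~R <= x 0 i] `&` [set x : V | x 0 i < eta * (k i)%:~R + eta])).
  apply: fin_bigcap_measurable => [|i _]; first exact: finite_finset.
  apply: measurableI.
    by apply: measurable_le_set; [exact: measurable_cst|exact: measurable_coord].
  by apply: measurable_lt_set; [exact: measurable_coord|exact: measurable_cst].
apply/seteqP; split => x; first by move=> h i _; have /andP[] := h i.
by move=> h i; have [h1 h2] := h i I; apply/andP.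
Qed.

Definition cell_of eta x : {ffun 'I_d -> int} := [ffun i => Num.floor (x 0 i / eta)].

Lemma cell_ofP eta k x : 0 < eta -> cell eta k x <-> cell_of eta x = k.
Proof.
move=> eta0; split=> [h|<- i]; last first.
  rewrite ffunE; have /andP[] := floor_itv (x 0 i / eta).
  by rewrite intrD ler_pdivlMr// ltr_pdivrMr// => h1 h2; apply/andP; split; lra.
apply/ffunP => i; rewrite ffunE; have /andP[h1 h2] := h i.
by apply: floor_def; rewrite intrD ler_pdivlMr// ltr_pdivrMr//; apply/andP; split; lra.
Qed.

Lemma cell_near eta k x y : 0 < eta -> cell eta k x -> cell eta k y ->
  enorm (x - y) <= d%:R * eta.
Proof.
move=> eta0 hx hy; apply: enorm_le_coord => [|i]; first exact: ltW.
have /andP[x1 x2] := hx i; have /andP[y1 y2] := hy i.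
by rewrite !mxE ler_norml; apply/andP; split; lra.
Qed.

Lemma cell_far eta k l x y x' y' : 0 < eta -> cell eta k x -> cell eta k x' ->
  cell eta l y -> cell eta l y' ->
  enorm (x - y) - 2 * (d%:R * eta) <= enorm (x' - y').
Proof.
move=> eta0 kx kx' ly ly'.
have h1 := cell_near eta0 kx kx'; have h2 := cell_near eta0 ly' ly.
have := ler_enorm_dist x' x y; have := ler_enorm_dist y' x' y; lra.
Qed.

Lemma points_in_gt0 s (A : set V) :
  points_in s A <> 0%N <-> exists2 x, x \in s & A x.
Proof.
rewrite points_in_eq0; split=> [/contrapT/hasP[x xs /asboolP Ax]|[x xs Ax]].
  by exists x.
by apply; apply/hasP; exists x => //; apply/asboolP.
Qed.

Lemma has_far_pair_limit r (a : R) s : 0 < r ->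
  (forall m, has_far_pair (r - a / m.+1%:R) s) -> has_far_pair r s.
Proof.
move=> r0 h; apply/(has_far_pair_diam _ r0); rewrite leNgt; apply/negP => dr.
pose b := Num.max a 1.
have b0 : 0 < b by rewrite lt_max ltr01 orbT.
have g0 : 0 < Num.min (r - diam [set` s]) r / b.
  by rewrite divr_gt0// lt_min subr_gt0 dr.
have [m] := ltr_add_invr g0; rewrite add0r ltr_pdivlMr// lt_min => /andP[m1 m2].
have ab : a / m.+1%:R <= m.+1%:R^-1 * b.
  by rewrite mulrC ler_pM2l ?invr_gt0// le_max lexx.
have rm : 0 < r - a / m.+1%:R by rewrite subr_gt0 (le_lt_trans ab).
have := h m; move/(has_far_pair_diam _ rm); rewrite lerBlDr => ram.
have := lt_le_trans (le_lt_trans ab m1) (lexx _); rewrite ltrBrDl => h'.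
by have := le_lt_trans ram h'; rewrite ltxx.
Qed.

End far_pairs.

Section measurable_far_pairs.
Context {R : realType} {d : nat}.
Local Notation V := 'rV[R]_d.
Context {dO} {Omega : measurableType dO} (P : probability Omega R).
Context (Lambda : {measure set V -> \bar R}).
Variables (Pi : Omega -> seq V) (hPi : poisson_process P Lambda Pi).

Let cell_event (eta r : R) (kl : {ffun 'I_d -> int} * {ffun 'I_d -> int}) : set Omega :=
  [set w | [/\ exists x y, [/\ cell eta kl.1 x, cell eta kl.2 y & r <= enorm (x - y)],
    points_in (Pi w) (cell eta kl.1) <> 0%N &
    points_in (Pi w) (cell eta kl.2) <> 0%N]].

(** Only counts in Borel sets are measurable by assumption; a far pair is
    detected, up to the mesh of a grid, by two occupied cells. *)
Lemma measurable_has_far_pair (r : R) : 0 < r ->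
  measurable [set w | has_far_pair r (Pi w)].
Proof.
move=> r0.
rewrite (_ : [set w | _] =
  \bigcap_m \bigcup_kl cell_event (m.+1%:R^-1) r kl); last first.
  apply/seteqP; split => w.
    move=> [x [y [xs ys xy]]] m _.
    have eta0 : 0 < m.+1%:R^-1 :> R by rewrite invr_gt0.
    pose k := cell_of m.+1%:R^-1 x; pose l := cell_of m.+1%:R^-1 y.
    have kx : cell m.+1%:R^-1 k x by exact/(cell_ofP _ _ eta0).
    have ly : cell m.+1%:R^-1 l y by exact/(cell_ofP _ _ eta0).
    exists (k, l) => //; split => /=.
    - by exists x, y.
    - by apply/points_in_gt0; exists x.
    - by apply/points_in_gt0; exists y.
  move=> h; apply: (@has_far_pair_limit _ _ _ (2 * d%:R)) => // m.
  have eta0 : 0 < m.+1%:R^-1 :> R by rewrite invr_gt0.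
  have [[k l] _ [/= [x [y [kx ly xy]]] /points_in_gt0[x' xs kx'] /points_in_gt0[y' ys ly']]] := h m I.
  exists x', y'; split => //.
  by apply: le_trans (cell_far eta0 kx kx' ly ly'); rewrite mulrA lerB.
apply: bigcapT_measurable => m; apply: countable_bigcupT_measurable => [|[k l]].
  exact: countableP.
rewrite /cell_event /=.
have [e|ne] := pselect (exists x y, [/\ cell m.+1%:R^-1 k x, cell m.+1%:R^-1 l y & r <= enorm (x - y)]); last first.
  rewrite (_ : mkset _ = set0); first exact: measurable0.
  by apply/seteqP; split => w //= [].
rewrite (_ : mkset _ =
  ~` [set w | points_in (Pi w) (cell m.+1%:R^-1 k) = 0%N] `&`
  ~` [set w | points_in (Pi w) (cell m.+1%:R^-1 l) = 0%N]).
  by apply: measurableI; apply: measurableC; apply: (measurable_void hPi); exact: measurable_cell.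
by apply/seteqP; split => w //= [].
Qed.

End measurable_far_pairs.

(** * Poisson approximation for far pairs *)

Section ball_partition.
Context {R : realType} {d : nat}.
Local Notation V := 'rV[R]_d.

Lemma ball_partition (mesh : R) : (0 < d)%N -> 0 < mesh ->
  exists (I : finType) (Q : I -> set V),
  [/\ (forall i, measurable (Q i)) /\ trivIset setT Q,
      forall i, Q i `<=` unit_ball,
      forall x, unit_ball x -> exists i, Q i x &
      forall i x y, Q i x -> Q i y -> enorm (x - y) <= mesh].
Proof.
move=> d0 mesh0; have dR : 0 < d%:R :> R by rewrite ltr0n.
pose eta := mesh / d%:R; have eta0 : 0 < eta by rewrite divr_gt0.
pose L := (Num.truncn (1 / eta)).+1.
have hL : 1 < eta * L%:R by rewrite mulrC -ltr_pdivrMr// truncnS_gt.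
pose I := {ffun 'I_d -> 'I_L.*2.+1}.
pose shift (k : I) : {ffun 'I_d -> int} := [ffun i => (k i)%:Z - L%:Z].
have shift_inj : injective shift.
  move=> k l kl; apply/ffunP => i; apply/val_inj/eqP; rewrite -eqz_nat.
  by have /ffunP/(_ i) := kl; rewrite !ffunE => /addIr ->.
exists I, (fun k => cell eta (shift k) `&` unit_ball); split.
- split=> [k|k l _ _ [x [[kx _] [lx _]]]].
    by apply: measurableI; [exact: measurable_cell|exact: measurable_unit_ball].
  move: kx lx => /(cell_ofP _ _ eta0) kx /(cell_ofP _ _ eta0) lx.
  by apply: shift_inj; rewrite -kx -lx.
- by move=> k x [].
- move=> x x1; pose k : I := [ffun i => inord (absz (cell_of eta x i + L%:Z))].
  exists k; split => //; apply/(cell_ofP _ _ eta0); apply/ffunP => i.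
  have := le_trans (ler_coord_enorm x i) x1; rewrite ler_norml => /andP[x2 x3].
  have /andP[f1 f2] := floor_itv (x 0 i / eta).
  move: f1 f2; rewrite intrD ler_pdivlMr// ltr_pdivrMr// => f1 f2.
  have fL : 0 <= cell_of eta x i + L%:Z <= L.*2%:Z.
    rewrite ffunE -(ler_int R) -(ler_int R _ L.*2) intrD.
    have L2 : (L.*2%:Z)%:~R = 2 * L%:R :> R by rewrite -pmulrn -muln2 natrM mulrC.
    rewrite L2 -pmulrn; set f := (Num.floor _)%:~R in f1 f2 *.
    have LR : - 1 < f + L%:R by rewrite -(ltr_pM2l eta0); lra.
    have f0 : 0 <= f + L%:R.
      rewrite /f [L%:R]pmulrn -intrD ler0z -ltzD1 -(ltr_int R) intrD intrD -pmulrn.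
      by rewrite -/f; lra.
    by rewrite f0 /= -(ler_pM2l eta0); nra.
  move: fL => /andP[fL1 fL2].
  rewrite [RHS]ffunE [k i]ffunE inordK; last by rewrite ltnS -lez_nat gez0_abs.
  by rewrite gez0_abs// addrK.
- move=> k x y [kx _] [ky _]; have := cell_near eta0 kx ky.
  by rewrite mulrC divfK ?gt_eqF.
Qed.

End ball_partition.

Section one_minus_exp.
Context {R : realType}.
Implicit Types a : R.

Lemma one_minus_exp_bounds a : 0 <= a ->
  [/\ 0 <= 1 - expR (- a) <= 1, 1 - expR (- a) <= a & a * (1 - a) <= 1 - expR (- a)].
Proof.
move=> a0; have e0 := expR_gt0 (- a); have e1 := expR_ge1Dx (- a).
have e2 := expR_ge1Dx a.
have ee : expR (- a) * expR a = 1 by rewrite -expRD addNr expR0.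
have e3 : expR (- a) * (1 + a) <= 1 by rewrite -[leRHS]ee ler_pM2l.
have h : expR (- a) <= 1 by nra.
split; [apply/andP; split; lra|lra|nra].
Qed.

End one_minus_exp.

Section sandwich.
Context {R : realType} {d : nat}.
Local Notation V := 'rV[R]_d.
Variables (kappa : probability V R).
Context {d0} {Omega0 : measurableType d0} (P0 : probability Omega0 R).
Variables (xi1 xi2 : {RV P0 >-> V}).
Context {dO} {Omega : measurableType dO} (P : probability Omega R).
Variables (n : nat) (Pi : Omega -> seq V).
Hypotheses (hd : (0 < d)%N) (hkappa : kappa unit_ball = 1%E).
Hypotheses (hxi1 : forall A, measurable A -> distribution P0 xi1 A = kappa A)
  (hxi2 : forall A, measurable A -> distribution P0 xi2 A = kappa A)
  (hindep : independent_rv xi1 xi2).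
Hypothesis hPi : poisson_process P (mscale n%:R%:nng kappa) Pi.

Definition far (r : R) (x : V) : set V := [set y | unit_ball y /\ r <= enorm (x - y)].

Lemma measurable_far r x : measurable (far r x).
Proof.
apply: measurableI; first exact: measurable_unit_ball.
apply: measurable_le_set; first exact: measurable_cst.
apply: measurable_enorm; apply: coord_measurableB; first exact: coord_measurable_cst.
exact: coord_measurable_id.
Qed.

Let kappaC : kappa (~` unit_ball) = 0%E.
Proof. by rewrite probability_setC ?hkappa ?subee//; exact: measurable_unit_ball. Qed.

Let xi_coord (xi : {RV P0 >-> V}) : coord_measurable xi.
Proof. by apply: coord_measurable_comp. Qed.

Lemma coord_measurable_diff : coord_measurable (xi1 \- xi2).
Proof. by apply: coord_measurableB; exact: xi_coord. Qed.

Let mpre (xi : {RV P0 >-> V}) A : measurable A -> measurable (xi @^-1` A).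
Proof. by move=> mA; rewrite -[X in measurable X]setTI; exact: measurable_funPT. Qed.

Section graph.
Variables (I : finType) (Q : I -> set V) (s theta delta : R).
Hypotheses (mQ : forall i, measurable (Q i)) (tQ : trivIset setT Q)
  (Qball : forall i, Q i `<=` unit_ball)
  (Qcover : forall x, unit_ball x -> exists i, Q i x)
  (Qmesh : forall i x y, Q i x -> Q i y -> enorm (x - y) <= theta / 2).
Hypotheses (theta0 : 0 < theta) (stheta : s + theta <= 1 / 2).
Hypotheses (delta0 : 0 <= delta) (delta2 : delta < 1 / 2).
Hypothesis hfar : forall x, unit_ball x ->
  n%:R * fine (kappa (far (2 - (s + theta)) x)) <= delta.

(** Asking for one pair of points at distance [2 - s] makes every far pair an
    edge; by the mesh condition all pairs of points of two such cells are then at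
    distance at least [2 - (s + theta)]. *)
Definition far_cells (i j : I) : bool :=
  `[< exists x y, [/\ Q i x, Q j y & 2 - s <= enorm (x - y)] >].

Let a i : R := n%:R * fine (kappa (Q i)).
Let p i : R := 1 - expR (- a i).

Let far_cells_sym : symmetric far_cells.
Proof.
by move=> i j; apply/asboolP/asboolP => -[x [y [h1 h2 h3]]];
  exists y, x; split => //; rewrite enormB.
Qed.

Let far_cells_irr : irreflexive far_cells.
Proof.
move=> i; apply/negbTE/asboolPn => -[x [y [ix iy]]].
have := Qmesh ix iy; move: theta0 stheta; lra.
Qed.

Let far_cellsP i j x y : far_cells i j -> Q i x -> Q j y ->
  2 - (s + theta) <= enorm (x - y).
Proof.
move=> /asboolP[x0 [y0 [ix0 jy0 h]]] ix jy.
have := ler_enorm_dist x x0 y0; have := ler_enorm_dist y x y0.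
have := Qmesh ix0 ix; have := Qmesh jy jy0; lra.
Qed.

Let a_ge0 i : 0 <= a i.
Proof. by rewrite mulr_ge0// fine_ge0. Qed.

Let kappa_fin A : measurable A -> kappa A \is a fin_num.
Proof. by move=> mA; rewrite fin_num_measure. Qed.

(* All neighbours of a cell are far from any fixed point of that cell. *)
Let degree_mass i : \sum_(j | far_cells i j) a j <= delta.
Proof.
have [[x ix]|Qi0] := pselect (Q i !=set0); last first.
  rewrite big_pred0// => j; apply/negbTE/asboolPn => -[x [y [ix _ _]]].
  by apply: Qi0; exists x.
rewrite -mulr_sumr; apply: le_trans (hfar (Qball ix)).
rewrite ler_wpM2l// sum_fine; last by move=> j _; exact: kappa_fin.
rewrite -measure_finU//; last exact: sub_trivIset tQ.
apply: fine_le.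
- by apply: kappa_fin; exact: measurable_finU.
- by apply: kappa_fin; exact: measurable_far.
apply: le_measure; rewrite ?inE.
- exact: measurable_finU.
- exact: measurable_far.
by move=> y [j ij jy]; split; [exact: Qball jy|exact: far_cellsP ij ix jy].
Qed.

(* A cell with a neighbour is itself among the neighbours of that one; this
   excludes heavy cells, such as those containing an atom of [kappa], wherever
   [p i] is compared with [a i]. *)
Let a_le i j : far_cells i j -> a i <= delta.
Proof.
rewrite far_cells_sym => ji; apply: le_trans (degree_mass j).
by rewrite (bigD1 i)//= lerDl sumr_ge0.
Qed.

Let p_bounds i : [/\ 0 <= p i <= 1, p i <= a i & a i * (1 - a i) <= p i].
Proof. exact: one_minus_exp_bounds. Qed.

Let degree_prob i : \sum_(j | far_cells i j) p j <= delta.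
Proof.
apply: le_trans (degree_mass i); apply: ler_sum => j _.
by have [] := p_bounds j.
Qed.

Let cell_mass : R := \sum_i \sum_(j | far_cells i j) a i * a j.

Let cell_pairs : set Omega0 :=
  \bigcup_(ij in [set` [pred ij : I * I | far_cells ij.1 ij.2]])
    (xi1 @^-1` Q ij.1 `&` xi2 @^-1` Q ij.2).

Let measurable_cell_pairs : measurable cell_pairs.
Proof. by apply: measurable_finU => ij _; apply: measurableI; exact: mpre. Qed.

Let cell_massE : cell_mass = n%:R ^+ 2 * fine (P0 cell_pairs).
Proof.
rewrite /cell_pairs measure_finU; last 2 first.
- by move=> ij _; apply: measurableI; exact: mpre.
- move=> [i j] [k l] _ _ [w [[/= h1 h2] [h3 h4]]].
  by congr (_, _); apply: tQ => //; [exists (xi1 w)|exists (xi2 w)].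
rewrite -sum_fine; last first.
  by move=> ij _; rewrite fin_num_measure//; apply: measurableI; exact: mpre.
rewrite mulr_sumr /cell_mass pair_big_dep/=; apply: eq_bigr => -[i j] _ /=.
rewrite hindep// (_ : P0 (xi1 @^-1` Q i) = kappa (Q i)); last exact: hxi1.
rewrite (_ : P0 (xi2 @^-1` Q j) = kappa (Q j)); last exact: hxi2.
by rewrite fineM ?kappa_fin// /a; ring.
Qed.

Let dist_prob (sigma : R) : R := fine (P0 (annulus (xi1 \- xi2) sigma)).

Let cell_mass_le : cell_mass <= n%:R ^+ 2 * dist_prob (s + theta).
Proof.
rewrite cell_massE ler_wpM2l ?sqr_ge0//.
have mann := measurable_annulus (s + theta) coord_measurable_diff.
apply: fine_le; rewrite ?fin_num_measure//.
apply: le_measure; rewrite ?inE// => w [[i j] /= ij [ix jy]].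
apply/andP; split; first exact: far_cellsP ij ix jy.
apply: le_trans (ler_enormB _ _) _; have := Qball ix; have := Qball jy.
by rewrite /unit_ball/=; lra.
Qed.

Let cell_mass_ge : n%:R ^+ 2 * dist_prob s <= cell_mass.
Proof.
rewrite cell_massE ler_wpM2l ?sqr_ge0//.
have mann := measurable_annulus s coord_measurable_diff.
pose out (xi : {RV P0 >-> V}) : set Omega0 := xi @^-1` (~` unit_ball).
have mball := @measurable_unit_ball R d.
have mout xi : measurable (out xi) by apply: mpre; exact: measurableC.
have out1 : P0 (out xi1) = 0%E by apply: etrans kappaC; apply: hxi1; exact: measurableC.
have out2 : P0 (out xi2) = 0%E by apply: etrans kappaC; apply: hxi2; exact: measurableC.
apply: fine_le; rewrite ?fin_num_measure//.
apply: (@le_trans _ _ (P0 (cell_pairs `|` (out xi1 `|` out xi2)))).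
  apply: le_measure; rewrite ?inE//.
    by apply: measurableU => //; exact: measurableU.
  move=> w /andP[h1 h2].
  have [b1|] := pselect (unit_ball (xi1 w)); last by right; left.
  have [b2|] := pselect (unit_ball (xi2 w)); last by right; right.
  have [i iw] := Qcover b1; have [j jw] := Qcover b2.
  by left; exists (i, j) => //=; apply/asboolP; exists (xi1 w), (xi2 w).
apply: (le_trans (measureU2 _ _ _)) => //; first exact: measurableU.
rewrite -[leRHS]adde0 leeD2l//.
apply: (@le_trans _ _ (P0 (out xi1) + P0 (out xi2))%E); first exact: measureU2.
by rewrite out1 out2 adde0.
Qed.

Let mass := edge_mass p far_cells finset.setT.

Let massE : mass = (\sum_i \sum_(j | far_cells i j) p i * p j) / 2.
Proof.
rewrite /mass /edge_mass; congr (_ / _); apply: eq_big => i; first by rewrite inE.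
by move=> _; apply: eq_bigl => j; rewrite inE.
Qed.

Let mass_le : mass <= n%:R ^+ 2 * dist_prob (s + theta) / 2.
Proof.
rewrite massE ler_pM2r//; apply: le_trans cell_mass_le.
apply: ler_sum => i _; apply: ler_sum => j _.
have [/andP[pi0 _] pia _] := p_bounds i; have [/andP[pj0 _] pja _] := p_bounds j.
exact: ler_pM.
Qed.

Let mass_ge : (1 - delta) ^+ 2 * (n%:R ^+ 2 * dist_prob s) / 2 <= mass.
Proof.
rewrite massE ler_pM2r//.
apply: (@le_trans _ _ ((1 - delta) ^+ 2 * cell_mass)).
  by rewrite ler_wpM2l ?sqr_ge0.
rewrite mulr_sumr; apply: ler_sum => i _; rewrite mulr_sumr; apply: ler_sum => j ij.
have [_ _ pia] := p_bounds i; have [_ _ pja] := p_bounds j.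
have ai := a_le ij; have aj : a j <= delta by apply: (@a_le j i); rewrite far_cells_sym.
have := a_ge0 i; have := a_ge0 j => aj0 ai0.
have d1 : 0 <= 1 - delta by move: delta2; lra.
have hi : (1 - delta) * a i <= p i by nra.
have hj : (1 - delta) * a j <= p j by nra.
have -> : (1 - delta) ^+ 2 * (a i * a j) = ((1 - delta) * a i) * ((1 - delta) * a j).
  by ring.
by apply: ler_pM => //; rewrite mulr_ge0.
Qed.

Let edge_event : set Omega :=
  [set w | predC (stable far_cells finset.setT) (active_cells Pi Q w)].

Let edge_prob : fine (P edge_event) =
  1 - active_prob p (stable far_cells finset.setT).
Proof.
rewrite (active_cells_prob hPi mQ tQ) /=.
have -> : (fun i => 1 - expR (- fine (mscale n%:R%:nng kappa (Q i)))) = p.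
  by apply/funext => i; rewrite /p /a /mscale /= fineM// kappa_fin.
set st := stable _ _.
have -> : 1 = active_prob p st + active_prob p (predC st).
  by rewrite -(active_probT p) (active_prob_split p predT st).
by rewrite addrC addKr.
Qed.

Let measurable_edge_event : measurable edge_event.
Proof. exact: (measurable_active hPi mQ). Qed.

Let edge_event_far w : edge_event w -> has_far_pair (2 - (s + theta)) (Pi w).
Proof.
move=> /negP st; apply: contrapT => no; apply: st; apply/stableP => i j _ _.
rewrite !inE => /eqP/points_in_gt0[x xw ix] /eqP/points_in_gt0[y yw jy].
by apply/negP => ij; apply: no; exists x, y; split => //; exact: far_cellsP ij ix jy.
Qed.

Let far_edge_event w : has_far_pair (2 - s) (Pi w) ->
  points_in (Pi w) (~` unit_ball) = 0%N -> edge_event w.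
Proof.
move=> [x [y [xw yw xy]]] out.
have ball z : z \in Pi w -> unit_ball z.
  move=> zw; apply: contrapT => nz.
  have : points_in (Pi w) (~` unit_ball) <> 0%N by apply/points_in_gt0; exists z.
  by rewrite out.
have [i ix] := Qcover (ball x xw); have [j jy] := Qcover (ball y yw).
apply/negP => /stableP/(_ i j); rewrite !finset.in_setT => /(_ isT isT).
have ij : far_cells i j by apply/asboolP; exists x, y.
rewrite !inE ij => st; suff : ~~ true by [].
by apply: st; apply/eqP/points_in_gt0; [exists x|exists y].
Qed.

Lemma far_pair_bounds_of_partition :
  fine (P [set w | has_far_pair (2 - s) (Pi w)]) <=
    1 - expR (- (n%:R ^+ 2 * dist_prob (s + theta) / 2 / (1 - delta))) /\
  1 - expR (- ((1 - 2 * delta) * ((1 - delta) ^+ 2 * (n%:R ^+ 2 * dist_prob s) / 2))) <=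
    fine (P [set w | has_far_pair (2 - (s + theta)) (Pi w)]).
Proof.
have p01 i : 0 <= p i <= 1 by have [] := p_bounds i.
have d02 : 0 <= delta < 1 / 2 by rewrite delta0.
have /andP[lo up] := stable_prob_bounds p01 far_cells_sym far_cells_irr degree_prob d02.
have d1 : 0 < 1 - delta by move: delta2; lra.
have d2 : 0 <= 1 - 2 * delta by move: delta2; lra.
have s0 : 0 < 2 - s by move: stheta theta0; lra.
have st0 : 0 < 2 - (s + theta) by move: stheta; lra.
have mfar r : 0 < r -> measurable [set w | has_far_pair r (Pi w)].
  exact: (measurable_has_far_pair hPi).
have mball := @measurable_unit_ball R d.
split; last first.
  apply: (@le_trans _ _ (fine (P edge_event))).
    rewrite edge_prob lerD2l lerN2; apply: le_trans up _.
    by rewrite ler_expR lerN2 ler_wpM2l// mass_ge.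
  apply: fine_le; rewrite ?fin_num_measure//; try exact: mfar.
  by apply: le_measure; rewrite ?inE//; exact: mfar.
apply: (@le_trans _ _ (fine (P edge_event))); last first.
  rewrite edge_prob lerD2l lerN2; apply: le_trans lo.
  by rewrite ler_expR lerN2 ler_pM2r ?invr_gt0// mass_le.
pose in_ball := [set w | points_in (Pi w) (~` unit_ball) = 0%N].
have m_in : measurable in_ball by apply: (measurable_void hPi); exact: measurableC.
have P_in : P in_ball = 1%E.
  rewrite /in_ball (void_prob hPi); last exact: measurableC.
  transitivity (expR (- fine (n%:R%:E * kappa (~` unit_ball)%classic)%E))%:E => //.
  by rewrite kappaC mule0 oppr0 expR0.
apply: fine_le; rewrite ?fin_num_measure//; try exact: mfar.
apply: (@le_trans _ _ (P (edge_event `|` ~` in_ball))).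
  apply: le_measure; rewrite ?inE//; first exact: mfar.
    by apply: measurableU => //; exact: measurableC.
  move=> w hw; have [iw|niw] := pselect (in_ball w); last by right.
  by left; exact: far_edge_event.
apply: (@le_trans _ _ (P edge_event + P (~` in_ball))%E).
  by apply: measureU2 => //; exact: measurableC.
by rewrite probability_setC// P_in subee// adde0.
Qed.

End graph.

(** Far pairs are essentially independent rare events, of expected number
    [n ^ 2 / 2] times the probability of the annulus. *)
Lemma far_pair_bounds (s theta delta : R) : 0 < theta -> s + theta <= 1 / 2 ->
  0 <= delta -> delta < 1 / 2 ->
  (forall x, unit_ball x -> n%:R * fine (kappa (far (2 - (s + theta)) x)) <= delta) ->
  fine (P [set w | has_far_pair (2 - s) (Pi w)]) <=
    1 - expR (- (n%:R ^+ 2 * fine (P0 (annulus (xi1 \- xi2) (s + theta))) / 2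
                 / (1 - delta))) /\
  1 - expR (- ((1 - 2 * delta) * ((1 - delta) ^+ 2 *
       (n%:R ^+ 2 * fine (P0 (annulus (xi1 \- xi2) s))) / 2))) <=
    fine (P [set w | has_far_pair (2 - (s + theta)) (Pi w)]).
Proof.
move=> theta0 st delta0 delta2 hfar.
have theta20 : 0 < theta / 2 by rewrite divr_gt0.
have [I [Q [[mQ tQ] Qball Qcover Qmesh]]] := @ball_partition R d _ hd theta20.
exact: (far_pair_bounds_of_partition mQ tQ Qball Qcover Qmesh).
Qed.

End sandwich.

(** * Limits *)

Section antipodal.
Context {R : realType} {d : nat}.
Local Notation V := 'rV[R]_d.

(** For [u] opposite to [x], the polarization of [enorm (x - y)] forces
    [inner y u] to be almost [1]. *)
Lemma far_sub_ball_caps (sg z : R) (x : V) : unit_ball x -> 0 < sg -> sg <= 1 / 2 ->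
  0 <= z -> far (2 - sg) x !=set0 ->
  exists2 u : V, unit_sphere u & far (2 - sg) x `<=` ball_caps (2 * sg) (cap u z).
Proof.
rewrite /unit_ball/= => x1 s0 s1 z0 [y0 [y01 xy0]].
have x0 : 0 < enorm x.
  by have := ler_enormB x y0; move: y01; rewrite /unit_ball/=; lra.
have [u u1 xu] : exists2 u : V, unit_sphere u & x = - (enorm x *: u).
  exists (- ((enorm x)^-1 *: x)).
    by rewrite /unit_sphere/= enormN; apply: normalize_sphere; rewrite gt_eqF.
  by rewrite scalerN opprK scalerA mulfV ?gt_eqF// scale1r.
exists u => // y [y1 xy]; exists u.
  by split => //; rewrite subrr enorm0.
split => //=.
have xy_u : inner x y = - (enorm x * inner y u).
  by rewrite {1}xu innerNl innerZl (innerC u).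
have : (2 - sg) ^+ 2 <= enorm (x - y) ^+ 2.
  by rewrite ler_pXn2r ?nnegrE ?enorm_ge0//; lra.
rewrite sqr_enorm !innerE -!sqr_enorm (innerC y x) xy_u.
move: y1; rewrite /unit_ball/= => y1.
have y0' := enorm_ge0 y.
move: x0 x1 y1 y0'; move: (inner y u) (enorm x) (enorm y) => c X Y x0 x1 y1 y0' h.
have X2 : X ^+ 2 <= 1 by nra.
have Y2 : Y ^+ 2 <= 1 by nra.
have h2 : 1 - 2 * sg <= X * c by nra.
have c0 : 0 <= c by rewrite -(pmulr_rge0 _ x0); lra.
by nra.
Qed.

End antipodal.

Section scaling.
Context {R : realType}.
Implicit Types (c : nat -> R) (a b t gamma : R).

(** At [a = 0] the power function is continuous from the right only. *)
Lemma cvg_powR_base c a gamma : 0 < gamma -> 0 <= a -> c n @[n --> \oo] --> a ->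
  (\forall n \near \oo, 0 < c n) -> c n `^ gamma @[n --> \oo] --> a `^ gamma.
Proof.
move=> g0; rewrite le_eqVlt => /predU1P[<-|a0] ca cpos.
  rewrite powR0 ?gt_eqF//.
  have h : c n @[n --> \oo] --> (0 : R)^'+.
    move=> A A0; have cA : \forall n \near \oo, 0 < c n -> A (c n) := ca _ A0.
    suff : \forall n \near \oo, A (c n) by [].
    near=> n; have cn : 0 < c n by near: n; exact: cpos.
    by move: cn; near: n; exact: cA.
  exact: (@cvg_comp _ _ _ c (fun x => x `^ gamma) _ _ _ h (powR_cvg0 g0)).
apply: (@cvg_comp _ _ _ c (fun x => x `^ gamma) _ _ _ ca).
have := @derivable_powR R 1 gamma a; rewrite in_itv/= andbT => /(_ a0).
by move/derivable1_diffP/differentiable_continuous.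
Unshelve. all: by end_near. Qed.

(** The order of magnitude of [2 - diam] for [n] points. *)
Definition scale gamma (n : nat) : R := n%:R `^ (- (2 / gamma)).

Lemma scale_gt0 gamma n : (0 < n)%N -> 0 < scale gamma n.
Proof. by move=> n0; apply: powR_gt0; rewrite ltr0n. Qed.

Lemma scale_powR gamma b n : 0 < gamma ->
  scale gamma n `^ (b * gamma) = n%:R `^ (- (2 * b)).
Proof.
move=> g0; rewrite /scale -powRrM; congr (_ `^ _).
by field; rewrite gt_eqF.
Qed.

Lemma cvg_scale gamma : 0 < gamma -> scale gamma n @[n --> \oo] --> (0 : R).
Proof.
move=> g0; have a0 : 0 < 2 / gamma by rewrite divr_gt0.
rewrite -(cvg_shiftS (scale gamma)).
have h : @harmonic R n `^ (2 / gamma) @[n --> \oo] --> (0 : R).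
  have := @cvg_powR_base (@harmonic R) 0 _ a0 (lexx _) cvg_harmonic _.
  rewrite powR0 ?gt_eqF//; apply; near=> n; exact: harmonic_gt0.
apply: cvg_trans h; apply: near_eq_cvg; near=> n.
rewrite /scale /harmonic /= -[n.+1%:R^-1]powR_inv1 ?ler0n// -powRrM; congr (_ `^ _).
by rewrite mulN1r.
Unshelve. all: by end_near. Qed.

Lemma near_scale gamma c a (A : set R) : 0 < gamma -> c n @[n --> \oo] --> a ->
  (\forall n \near \oo, 0 < c n) -> (\forall s \near (0 : R)^'+, A s) ->
  \forall n \near \oo, A (c n * scale gamma n).
Proof.
move=> g0 ca cpos hA.
have h0 : c n * scale gamma n @[n --> \oo] --> (0 : R).
  by rewrite -(mulr0 a); apply: cvgM => //; exact: cvg_scale.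
have cA : \forall n \near \oo,
  0 < c n * scale gamma n -> A (c n * scale gamma n) := h0 _ hA.
near=> n.
have cn : 0 < c n * scale gamma n.
  apply: mulr_gt0; first by near: n; exact: cpos.
  by apply: scale_gt0; near: n; exact: nbhs_infty_gt.
by move: cn; near: n; exact: cA.
Unshelve. all: by end_near. Qed.

End scaling.

Section scaled_tail.
Context {R : realType} {d : nat}.
Local Notation V := 'rV[R]_d.
Context {dT} {T : measurableType dT} (P : probability T R) (X : T -> V).
Variables (sigma : {finite_measure set V -> \bar R}).
Variables (gamma delta1 delta2 : R).
Hypotheses (hd : (0 < d)%N) (mX : coord_measurable X) (hgamma : 0 < gamma).
Hypotheses (hdelta1 : 0 < delta1) (hdelta12 : delta1 < delta2).
Hypothesis hratio : forall eps : R, 0 < eps -> \forall s \near (0 : R)^'+,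
    forall (u : V) (z : R), unit_sphere u ->
      s `^ delta2 <= z <= s `^ delta1 ->
      ratio_near1 eps (fine (P (X @^-1` thick_cap s u z)))
        (s `^ gamma * fine (sigma (cap u z))).

Let sigma0 := fine (sigma unit_sphere).

Lemma cvg_tail_ratio :
  fine (P (annulus X s)) / s `^ gamma @[s --> (0 : R)^'+] --> sigma0.
Proof.
have sig0 : 0 <= sigma0 by exact: fine_ge0.
apply/cvgrPdist_le => e e0.
pose e' := Num.min 1 (e / (3 * (sigma0 + 1))).
have D0 : 0 < 3 * (sigma0 + 1) by lra.
have e'0 : 0 < e' by rewrite lt_min ltr01 divr_gt0.
have e'1 : e' <= 1 by rewrite ge_min lexx.
have e'e : e' * (3 * (sigma0 + 1)) <= e.
  by rewrite -ler_pdivlMr// ge_min lexx orbT.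
near=> s.
have s0 : 0 < s by near: s; exact: nbhs_right_gt.
have sg0 : 0 < s `^ gamma by exact: powR_gt0.
have h : `|fine (P (annulus X s)) - s `^ gamma * sigma0| <= 3 * e' * (s `^ gamma * sigma0).
  by near: s; exact: (tail_equiv hd mX hdelta1 hdelta12 hratio).
rewrite distrC -(ler_pM2r sg0) -{2}(gtr0_norm sg0) -normrM mulrBl divfK ?gt_eqF//.
rewrite [sigma0 * _]mulrC; apply: (le_trans h).
rewrite mulrCA [e * _]mulrC ler_pM2l//; nra.
Unshelve. all: by end_near. Qed.

Lemma cvg_scaled_tail (c : nat -> R) (a : R) : 0 <= a -> c n @[n --> \oo] --> a ->
  (\forall n \near \oo, 0 < c n) ->
  n%:R ^+ 2 * fine (P (annulus X (c n * scale gamma n))) @[n --> \oo]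
    --> a `^ gamma * sigma0.
Proof.
move=> a0 ca cpos.
have h1 : fine (P (annulus X (c n * scale gamma n))) / (c n * scale gamma n) `^ gamma
    @[n --> \oo] --> sigma0.
  move=> A A0.
  exact: (near_scale hgamma ca cpos (cvg_tail_ratio A0)).
apply: cvg_trans (cvgM (cvg_powR_base hgamma a0 ca cpos) h1).
apply: near_eq_cvg; near=> n.
have n0 : (0 < n)%N by near: n; exact: nbhs_infty_gt.
have cn : 0 < c n by near: n; exact: cpos.
have nR : n%:R != 0 :> R by rewrite pnatr_eq0 -lt0n.
have scE : scale gamma n `^ gamma = (n%:R ^+ 2)^-1.
  rewrite -[X in _ `^ X]mul1r (scale_powR _ _ hgamma)// mulr1 powRN.
  by rewrite powR_mulrn ?ler0n.
rewrite /= powRM ?(ltW cn) ?powR_ge0// scE.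
have := powR_gt0 gamma cn => cg.
field; rewrite nR /=; lra.
Unshelve. all: by end_near. Qed.

(** For [a = 0] the annulus is empty and both sides vanish. *)
Lemma cvg_scaled_tail_below (c : nat -> R) (a : R) : 0 <= a -> c n @[n --> \oo] --> a ->
  (forall n, c n < a) ->
  n%:R ^+ 2 * fine (P (annulus X (c n * scale gamma n))) @[n --> \oo]
    --> a `^ gamma * sigma0.
Proof.
rewrite le_eqVlt => /predU1P[<-|a0] ca cla; last first.
  by apply: cvg_scaled_tail => //; [exact: ltW|exact: (cvgr_gt a)].
rewrite powR0 ?gt_eqF// mul0r; apply: cvg_near_cst; near=> n.
have n0 : (0 < n)%N by near: n; exact: nbhs_infty_gt.
rewrite (_ : annulus _ _ = set0) ?measure0 ?mulr0//.
apply/seteqP; split => w //= /andP[h1 h2].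
have := cla n; have := scale_gt0 gamma n0; nra.
Unshelve. all: by end_near. Qed.

End scaled_tail.

Section far_mass.
Context {R : realType} {d : nat}.
Local Notation V := 'rV[R]_d.
Variables (kappa : probability V R) (gamma delta1 delta2 : R).
Hypotheses (hgamma : 0 < gamma) (hdelta12 : delta1 < delta2).
Hypothesis hcaps : forall eps : R, 0 < eps -> \forall s \near (0 : R)^'+,
    forall (u : V) (z : R), unit_sphere u ->
      s `^ delta2 <= z <= s `^ delta1 ->
      s `^ (- (gamma / 2)) * fine (kappa (ball_caps s (cap u z))) <= eps.

Lemma far_mass_small (a eps : R) : 0 < a -> 0 < eps ->
  \forall n \near \oo, forall x : V, unit_ball x ->
    n%:R * fine (kappa (far (2 - a * scale gamma n) x)) <= eps.
Proof.
move=> a0 eps0.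
pose C := (2 * a) `^ (gamma / 2).
have C0 : 0 < C by apply: powR_gt0; rewrite mulr_gt0.
have a20 : 0 < 2 * a by rewrite mulr_gt0.
have eC0 : 0 < eps / C by rewrite divr_gt0.
have g2 : 0 < gamma / 2 by rewrite divr_gt0.
have pos : \forall n \near \oo, 0 < cst (2 * a) (n : nat) by near=> n.
have small := near_scale hgamma (cvg_cst (2 * a)) pos (nbhs_right_le (ltr01 : 0 < 1 :> R)).
have capsn := near_scale hgamma (cvg_cst (2 * a)) pos (hcaps eC0).
near=> n => x x1.
have n0 : (0 < n)%N by near: n; exact: nbhs_infty_gt.
have nR : 0 < n%:R :> R by rewrite ltr0n.
have sc0 := scale_gt0 gamma n0.
pose s := 2 * a * scale gamma n.
have s0 : 0 < s by rewrite mulr_gt0.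
have s1 : s <= 1 by rewrite /s; near: n; exact: small.
have caps : forall (u : V) (z : R), unit_sphere u -> s `^ delta2 <= z <= s `^ delta1 ->
    s `^ (- (gamma / 2)) * fine (kappa (ball_caps s (cap u z))) <= eps / C.
  by rewrite /s; near: n; exact: capsn.
have [far0|far0] := pselect (far (2 - a * scale gamma n) x !=set0); last first.
  move/set0P/negP/negPn/eqP: far0 => ->; rewrite measure0 mulr0; exact: ltW.
have as0 : 0 < a * scale gamma n by rewrite mulr_gt0.
have as1 : a * scale gamma n <= 1 / 2 by move: s1; rewrite /s; lra.
have [u u1 sub] := far_sub_ball_caps x1 as0 as1 (powR_ge0 s delta2) far0.
have := caps u (s `^ delta2) u1; rewrite lexx /=.
have -> : s `^ delta2 <= s `^ delta1 by apply: ger_powR; rewrite ?s0// ltW.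
move=> /(_ isT); rewrite powRN mulrC ler_pdivrMr ?powR_gt0// => kb.
have sE : s `^ (gamma / 2) = C / n%:R.
  rewrite /s powRM ?(ltW a20) ?(ltW sc0)// -/C; congr (_ * _).
  have -> : gamma / 2 = 2^-1 * gamma by rewrite mulrC.
  rewrite (scale_powR _ _ hgamma)// (_ : 2 * 2^-1 = 1 :> R); last by field.
  by rewrite powR_inv1// ltW.
apply: (@le_trans _ _ (n%:R * fine (kappa (ball_caps s (cap u (s `^ delta2)))))).
  rewrite ler_pM2l//; apply: fine_le.
  - by rewrite fin_num_measure//; exact: measurable_far.
  - by rewrite fin_num_measure//; exact: measurable_ball_caps.
  apply: le_measure; rewrite ?inE; [exact: measurable_far|exact: measurable_ball_caps|].
  by move: sub; rewrite [2 * (_ * _)]mulrA.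
apply: (le_trans (ler_wpM2l (ltW nR) kb)); rewrite sE.
rewrite (_ : n%:R * (eps / C * (C / n%:R)) = eps)//.
by field; rewrite !gt_eqF.
Unshelve. all: by end_near. Qed.

(** The largest expected number of points of the process at distance almost [2]
    from a point of the ball. *)
Definition far_mass (a : R) (n : nat) : R :=
  sup [set n%:R * fine (kappa (far (2 - a * scale gamma n) x)) | x in unit_ball].

Lemma far_mass_ub (a : R) n (x : V) : unit_ball x ->
  n%:R * fine (kappa (far (2 - a * scale gamma n) x)) <= far_mass a n.
Proof.
move=> x1; apply: ub_le_sup; last by exists x.
exists n%:R => _ [y _ <-]; rewrite ler_piMr// -lee_fin fineK.
  by apply: probability_le1; exact: measurable_far.
by rewrite fin_num_measure//; exact: measurable_far.
Qed.

Let unit_ball0 : unit_ball (0 : V).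
Proof. by rewrite /unit_ball/= enorm0. Qed.

Lemma far_mass_ge0 (a : R) n : 0 <= far_mass a n.
Proof. by apply: le_trans (far_mass_ub a n unit_ball0); rewrite mulr_ge0// fine_ge0. Qed.

Lemma cvg_far_mass (a : R) : 0 < a -> far_mass a n @[n --> \oo] --> (0 : R).
Proof.
move=> a0; apply/cvgrPdist_le => e e0; near=> n.
rewrite sub0r normrN ger0_norm ?far_mass_ge0//.
apply: ge_sup; first by eexists; exists 0.
by move=> _ [x x1 <-]; move: x x1; near: n; exact: far_mass_small.
Unshelve. all: by end_near. Qed.

End far_mass.

Theorem theorem2p7 (R : realType) (d : nat) (hd : (2 <= d)%N)
  (kappa : probability 'rV[R]_d R)
  (hkappa : kappa unit_ball = 1%E)
  (d0 : measure_display) (Omega0 : measurableType d0)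
  (P0 : probability Omega0 R) (xi1 xi2 : {RV P0 >-> 'rV[R]_d})
  (hxi1 : forall A, measurable A -> distribution P0 xi1 A = kappa A)
  (hxi2 : forall A, measurable A -> distribution P0 xi2 A = kappa A)
  (hindep : independent_rv xi1 xi2)
  (hsupport : forall eps : R, 0 < eps -> exists x : 'rV[R]_d,
    msupport (pushforward P0 (xi1 \- xi2)) x /\ `|enorm x - 2| < eps)
  (sigma : {finite_measure set 'rV[R]_d -> \bar R})
  (hsigma : sigma (~` unit_sphere) = 0%E)
  (hsigma0 : sigma unit_sphere != 0%E)
  (gamma delta1 delta2 : R) (hgamma : 0 < gamma)
  (hdelta1 : 0 < delta1) (hdelta12 : delta1 < delta2) (hdelta2 : delta2 < 1 / 2)
  (hratio : forall eps : R, 0 < eps -> \forall s \near (0 : R)^'+,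
    forall (u : 'rV[R]_d) (z : R), unit_sphere u ->
      s `^ delta2 <= z <= s `^ delta1 ->
      ratio_near1 eps
        (fine (P0 ((xi1 \- xi2) @^-1` thick_cap s u z)))
        (s `^ gamma * fine (sigma (cap u z))))
  (hcaps : forall eps : R, 0 < eps -> \forall s \near (0 : R)^'+,
    forall (u : 'rV[R]_d) (z : R), unit_sphere u ->
      s `^ delta2 <= z <= s `^ delta1 ->
      s `^ (- (gamma / 2)) * fine (kappa (ball_caps s (cap u z))) <= eps)
  (f : R -> R) (hf : f x @[x --> 0^'+] --> 0)
  (hsigmaf : forall A : set 'rV[R]_d, measurable A -> A `<=` unit_sphere ->
    (sigma A <= (f (fine (surface_area A)))%:E)%E)
  (dO : nat -> measure_display) (Omega : forall n, measurableType (dO n))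
  (P : forall n, probability (Omega n) R)
  (Pi : forall n, Omega n -> seq 'rV[R]_d)
  (hPi : forall n, poisson_process (P n) (mscale n%:R%:nng kappa) (Pi n))
  (t : R) (ht : 0 <= t) :
  P n [set w | n%:R `^ (2 / gamma) * (2 - diam [set` Pi n w]) <= t]
    @[n --> \oo]
  --> (1 - expR (- (1 / 2 * t `^ gamma * fine (sigma unit_sphere))))%:E.
Proof.
have d_gt0 : (0 < d)%N by exact: ltnW.
have mX := coord_measurable_diff xi1 xi2.
set sigma0 := fine (sigma unit_sphere).
have t1 : 0 < t + 1 by rewrite ltr_wpDl.
pose delta n := far_mass kappa gamma (t + 1) n.
have delta_cvg : delta n @[n --> \oo] --> (0 : R).
  exact: (cvg_far_mass hgamma hdelta12 hcaps t1).
have delta_ge0 n : 0 <= delta n by exact: far_mass_ge0.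
pose q (c : nat -> R) n :=
  n%:R ^+ 2 * fine (P0 (annulus (xi1 \- xi2) (c n * scale gamma n))).
(* The event at [t] is compared with the graphs for [s = t * scale gamma n] and
   [s = (t - 1 / (n + 1)) * scale gamma n], both with slack
   [theta = scale gamma n / (n + 1)]. *)
pose cu n := t + @harmonic R n; pose cl n := t - @harmonic R n.
have cu_cvg : cu n @[n --> \oo] --> t.
  by rewrite -[X in _ --> X]addr0; apply: cvgD; [exact: cvg_cst|exact: cvg_harmonic].
have cl_cvg : cl n @[n --> \oo] --> t.
  by rewrite -[X in _ --> X]subr0; apply: cvgB; [exact: cvg_cst|exact: cvg_harmonic].
have qu_cvg : q cu n @[n --> \oo] --> t `^ gamma * sigma0.
  apply: (cvg_scaled_tail d_gt0 mX hgamma hdelta1 hdelta12 hratio ht cu_cvg).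
  by near=> n; rewrite ltr_wpDl// harmonic_gt0.
have ql_cvg : q cl n @[n --> \oo] --> t `^ gamma * sigma0.
  apply: (cvg_scaled_tail_below d_gt0 mX hgamma hdelta1 hdelta12 hratio ht cl_cvg).
  by move=> n; rewrite gtrDl oppr_lt0 harmonic_gt0.
pose upper n := 1 - expR (- (q cu n / 2 / (1 - delta n))).
pose lower n := 1 - expR (- ((1 - 2 * delta n) * ((1 - delta n) ^+ 2 * q cl n / 2))).
pose D n := [set w | n%:R `^ (2 / gamma) * (2 - diam [set` Pi n w]) <= t].
have mfar n r : 0 < r -> measurable [set w | has_far_pair r (Pi n w)].
  exact: (measurable_has_far_pair (hPi n)).
have sc_small : \forall n \near \oo, (t + 1) * scale gamma n <= 1 / 2.
  have half_gt0 : 0 < 1 / 2 :> R by rewrite divr_gt0.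
  have pos : \forall n \near \oo, 0 < cst (t + 1) (n : nat) by near=> n.
  exact: (near_scale hgamma (cvg_cst (t + 1)) pos (nbhs_right_le half_gt0)).
have DE n : (0 < n)%N -> (t + 1) * scale gamma n <= 1 / 2 ->
    D n = [set w | has_far_pair (2 - t * scale gamma n) (Pi n w)].
  move=> n0 small; have sc0 := scale_gt0 gamma n0.
  have r0 : 0 < 2 - t * scale gamma n by nra.
  have scE : n%:R `^ (2 / gamma) = (scale gamma n)^-1 by rewrite /scale powRN invrK.
  apply/seteqP; split => w; rewrite /D/= scE ler_pdivrMl//.
    by rewrite mulrC => h; apply/(has_far_pair_diam _ r0); lra.
  by move/(has_far_pair_diam _ r0); rewrite mulrC; lra.
have bounds : \forall n \near \oo, lower n <= fine (P n (D n)) <= upper n.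
  near=> n.
  have n0 : (0 < n)%N by near: n; exact: nbhs_infty_gt.
  have sc0 := scale_gt0 gamma n0.
  have small : (t + 1) * scale gamma n <= 1 / 2 by near: n.
  have h0 : 0 < @harmonic R n := harmonic_gt0 n.
  have h1 : @harmonic R n <= 1 by rewrite invf_le1 ?ltr0n// ler1n.
  have theta0 : 0 < harmonic n * scale gamma n by rewrite mulr_gt0.
  have delta2' : delta n < 1 / 2.
    by near: n; apply: (cvgr_lt (0 : R)); [exact: delta_cvg|rewrite divr_gt0].
  have hfar c : c <= t + 1 -> forall x, unit_ball x ->
      n%:R * fine (kappa (far (2 - c * scale gamma n) x)) <= delta n.
    move=> ct x x1; apply: le_trans (far_mass_ub kappa gamma (t + 1) n x1).
    rewrite ler_wpM2l//; apply: fine_le.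
    - by rewrite fin_num_measure//; exact: measurable_far.
    - by rewrite fin_num_measure//; exact: measurable_far.
    apply: le_measure; rewrite ?inE; [exact: measurable_far|exact: measurable_far|].
    move=> y [y1 xy]; split => //; apply: le_trans xy.
    by rewrite lerD2l lerN2 ler_pM2r.
  rewrite DE//; apply/andP; split.
    have st : cl n * scale gamma n + harmonic n * scale gamma n = t * scale gamma n.
      by rewrite -mulrDl subrK.
    have := far_pair_bounds d_gt0 hkappa hxi1 hxi2 hindep (hPi n) theta0
      (s := cl n * scale gamma n) (delta := delta n).
    rewrite st; case => //; first by nra.
    by apply: hfar; lra.
  have st : t * scale gamma n + harmonic n * scale gamma n = cu n * scale gamma n.
    by rewrite -mulrDl.
  have := far_pair_bounds d_gt0 hkappa hxi1 hxi2 hindep (hPi n) theta0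
    (s := t * scale gamma n) (delta := delta n).
  rewrite st; case => //; first by rewrite /cu; nra.
  by apply: hfar; rewrite lerD2l.
apply: cvg_EFin.
  near=> n; have n0 : (0 < n)%N by near: n; exact: nbhs_infty_gt.
  have small : (t + 1) * scale gamma n <= 1 / 2 by near: n.
  have sc0 := scale_gt0 gamma n0.
  by rewrite -/(D n) DE// fin_num_measure//; apply: mfar; nra.
have one_delta : 1 - delta n @[n --> \oo] --> (1 : R).
  by rewrite -[X in _ --> X]subr0; apply: cvgB => //; exact: cvg_cst.
have expR_cvg (u : nat -> R) (l : R) : u n @[n --> \oo] --> l ->
    1 - expR (- u n) @[n --> \oo] --> 1 - expR (- l).
  move=> ul; apply: cvgB; first exact: cvg_cst.
  by apply: continuous_cvg; [exact: continuous_expR|exact: cvgN].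
apply: (squeeze_cvgr bounds).
- rewrite (_ : 1 / 2 * t `^ gamma * sigma0 =
    (1 - 2 * 0) * (1 ^+ 2 * (t `^ gamma * sigma0) / 2)); last by field.
  apply: expR_cvg; apply: cvgM.
    by apply: cvgB; [exact: cvg_cst|apply: cvgM => //; exact: cvg_cst].
  apply: cvgM; last exact: cvg_cst.
  by apply: cvgM => //; rewrite expr2; apply: cvgM.
- rewrite (_ : 1 / 2 * t `^ gamma * sigma0 = t `^ gamma * sigma0 / 2 / 1); last by field.
  apply: expR_cvg; apply: cvgM; first by apply: cvgM => //; exact: cvg_cst.
  by apply: cvgV => //; rewrite oner_neq0.
Unshelve. all: by end_near. Qed.
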